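(* Let $(N,g,I_1,I_2,I_3)$ be a (pseudo-)hyper-Kähler manifold with Levi-Civita connection $D$ and a rotating circle action generated by the vector field $Z$, with Hamiltonian $f_Z$ (so $\iota_Z\omega_1=-\mathrm{d}f_Z$). Let $(\bar N,g_{\mathrm Q})$ be its image under the HK/QK correspondence, i.e. the twist of $(N,g_{\mathrm H})$ with respect to the twist data $(Z,\omega_{\mathrm H},f_{\mathrm H})$. Then the Levi-Civita connection $D^{\mathrm Q}$ of $g_{\mathrm Q}$ is $\mathcal H$-related to the connection $\nabla^S=D+S$ on $N$, where for all vector fields $A,B$ on $N$ $$S_AB=\frac12\sum_{\mu=0}^3\left(\frac1{f_{\mathrm H}}\,g(I_\mu I_{\mathrm H}A,B)\,I_\mu Z-\frac1{f_Z}\big(\alpha_\mu(A)\,I_\mu I_1B+\alpha_\mu(B)\,I_\mu I_1A\big)\right).$$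
   Context: Hyper-Kähler data. $g$ is a (pseudo-)Riemannian metric, $D$ its Levi-Civita connection, and $I_1,I_2,I_3$ are $g$-orthogonal, $D$-parallel almost complex structures with $I_1I_2=I_3=-I_2I_1$; $\omega_k=g(I_k\cdot,\cdot)$. Put $I_0=\mathrm{id}$, $\omega_0=g$; Greek indices run over $0,1,2,3$. $Z$ generates a free circle action which is rotating: $L_Zg=0$, $L_Z\omega_1=0$, $L_Z\omega_2=\omega_3$, $L_Z\omega_3=-\omega_2$; $f_Z$ is a function with $\iota_Z\omega_1=-\mathrm{d}f_Z$. Put $\alpha_\mu=\iota_Z\omega_\mu$, $f_{\mathrm H}=f_Z+g(Z,Z)$, $\omega_{\mathrm H}=\omega_1+\mathrm{d}(\iota_Zg)$, $I_{\mathrm H}=I_1+2DZ$ (so $\omega_{\mathrm H}=g(I_{\mathrm H}\cdot,\cdot)$), and define the elementary deformation $g_{\mathrm H}=\frac1{f_Z}g+\frac1{f_Z^2}\sum_{\mu=0}^3\alpha_\mu^2$, where $\alpha_\mu^2=\alpha_\mu\otimes\alpha_\mu$. Standing assumptions: $f_Z$ and $f_{\mathrm H}$ are nowhere vanishing and $\omega_1$ is integral. Twist construction. With twist data $(Z,\omega_{\mathrm H},f_{\mathrm H})$ (one has $\iota_Z\omega_{\mathrm H}=-\mathrm{d}f_{\mathrm H}$), let $\pi_N:P\to N$ be a principal circle bundle with connection form $\eta$, $\mathrm{d}\eta=\pi_N^*\omega_{\mathrm H}$, and principal generator $X_P$, $\eta(X_P)=1$; $\mathcal H=\ker\eta$.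 Let $Z_P=\tilde Z+(\pi_N^*f_{\mathrm H})X_P$, with $\tilde Z$ the $\eta$-horizontal lift of $Z$. The twist is $\bar N=P/\langle Z_P\rangle$ with projection $\pi_{\bar N}$ (if the orbit space is not globally a manifold this is understood locally, replacing $P$ by an open subset on which it is). Both $T N$ and $T\bar N$ are pointwise identified with $\mathcal H$, so tensor fields on $N$ and $\bar N$ have lifts to $\mathcal H$ (horizontal lifts for vectors, restriction of the pullback for forms); $Z$-invariant $T$ on $N$ and $T'$ on $\bar N$ are $\mathcal H$-related, $T\sim_{\mathcal H}T'$, if their lifts agree. $g_{\mathrm Q}$ is the metric on $\bar N$ with $g_{\mathrm H}\sim_{\mathcal H}g_{\mathrm Q}$. A $Z$-invariant connection $\nabla$ on $N$ is $\mathcal H$-related to a connection $\nabla'$ on $\bar N$ if $\nabla_AB\sim_{\mathcal H}\nabla'_{A'}B'$ for all $Z$-invariant vector fields $A\sim_{\mathcal H}A'$, $B\sim_{\mathcal H}B'$. *)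

(* Defs.v *)
From HB Require Import structures.
From mathcomp Require Import all_boot all_order all_algebra.
From mathcomp Require Import all_classical all_reals all_analysis.
From mathcomp Require Import ring.

Set Implicit Arguments.
Unset Strict Implicit.
Unset Printing Implicit Defensive.

Import Order.TTheory GRing.Theory Num.Theory.
Import numFieldNormedType.Exports.

Local Open Scope classical_set_scope.
Local Open Scope ring_scope.

(* [U] is meant to be open. *)
Fixpoint is_Ck (R : realType) (n k : nat) (U : set 'rV[R]_n)
    (f : 'rV[R]_n -> R) : Prop :=
  match k with
  | 0 => forall x, U x -> {for x, continuous f}
  | k'.+1 => (forall x, U x -> differentiable f x) /\
             (forall v, is_Ck k' U (fun x => 'D_v f x))
  end.

Definition is_Coo (R : realType) (n : nat) (U : set 'rV[R]_n)
    (f : 'rV[R]_n -> R) : Prop := forall k, is_Ck k U f.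

(* The atlas need not be maximal.  [mcoord i] and [mparam i] are total functions
   that are only meaningful on the domain [mdom i] of the chart and on its image
   respectively. *)
Record manifold (R : realType) (n : nat) := Manifold {
  mcarrier :> topologicalType ;
  matlas : Type ;
  mdom : matlas -> set mcarrier ;
  mcoord : matlas -> mcarrier -> 'rV[R]_n ;
  mparam : matlas -> 'rV[R]_n -> mcarrier ;
  mhausdorff : hausdorff_space mcarrier ;
  mcountable : @second_countable mcarrier ;
  mcover : forall x, exists i, mdom i x ;
  mdom_open : forall i, open (mdom i) ;
  mimage_open : forall i, open (mcoord i @` mdom i) ;
  mcoordK : forall i x, mdom i x -> mparam i (mcoord i x) = x ;
  mcoord_continuous : forall i x, mdom i x -> {for x, continuous (mcoord i)} ;
  mparam_continuous : forall i y, (mcoord i @` mdom i) y ->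
    {for y, continuous (mparam i)} ;
  mtransition : forall i j (k : 'I_n),
    is_Coo (mcoord i @` (mdom i `&` mdom j))
           (fun y => mcoord j (mparam i y) 0 k) }.

Lemma near_eq_continuous (S T : topologicalType) (f g : S -> T) (x : S) :
  (\near x, f x = g x) -> {for x, continuous f} -> {for x, continuous g}.
Proof.
move=> fg; rewrite /prop_for /continuous_at -(nbhs_singleton fg).
by apply: cvg_trans; exact: near_eq_cvg.
Qed.

Lemma near_eq_differentiable (K : numFieldType) (V W : normedModType K)
    (f g : V -> W) (x : V) :
  (\near x, f x = g x) -> differentiable f x -> differentiable g x.
Proof.
move=> fg dfx; have [cf Hf] := (diff_locallyP _ _).1 dfx.
have Hg : g \o shift x = cst (g x) + 'd f x +o_ 0 id.
  apply/eqaddoP => e e0; move/eqaddoP: Hf => /(_ e e0).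
  have := fg; rewrite (near_shift 0 x) subr0 => fg0.
  apply: filterS2 fg0 => h /= fgh.
  by rewrite !fctE /= fgh -(nbhs_singleton fg).
by apply/diff_locallyP; rewrite (diff_unique cf Hg).
Qed.

Section SmoothFunctions.
Context {R : realType} {n : nat}.
Implicit Types (U : set 'rV[R]_n) (f g : 'rV[R]_n -> R).

Lemma is_Ck_eq k U f g : open U -> (forall x, U x -> f x = g x) ->
  is_Ck k U f -> is_Ck k U g.
Proof.
move=> oU.
have E f' g' x : (forall x, U x -> f' x = g' x) -> U x -> \near x, f' x = g' x.
  move=> fg Ux; have := open_nbhs_nbhs (conj oU Ux); apply: filterS => y; exact: fg.
elim: k f g => [|k IH] f g fg /=.
  by move=> cf x Ux; exact: near_eq_continuous (E _ _ _ fg Ux) (cf x Ux).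
move=> [df Df]; split=> [x Ux|v].
  exact: near_eq_differentiable (E _ _ _ fg Ux) (df x Ux).
apply: IH (Df v) => x Ux; exact: near_eq_derive (E _ _ _ fg Ux).
Qed.

Lemma is_CkS k U f : is_Ck k.+1 U f -> is_Ck k U f.
Proof.
elim: k f => [|k IH] f [df Df] /=.
  by move=> x Ux; exact/differentiable_continuous/df.
by split=> // v; exact/IH/Df.
Qed.

Lemma is_Ck_cst k U (c : R) : open U -> is_Ck k U (fun=> c).
Proof.
move=> oU; elim: k c => [|k IH] c /=; first by move=> x _; exact: cst_continuous.
split=> [x _|v]; first exact: differentiable_cst.
by apply: is_Ck_eq (IH 0) => // x _; rewrite derive_cst.
Qed.

Lemma is_CkD k U f g : open U ->
  is_Ck k U f -> is_Ck k U g -> is_Ck k U (fun x => f x + g x).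
Proof.
move=> oU; elim: k f g => [|k IH] f g /=.
  by move=> cf cg x Ux; apply: continuousD; [exact: cf|exact: cg].
move=> [df Df] [dg Dg]; split=> [x Ux|v].
  by apply: differentiableD; [exact: df|exact: dg].
apply: is_Ck_eq (IH _ _ (Df v) (Dg v)) => // x Ux.
by rewrite -deriveD; [|exact: diff_derivable (df x Ux)|exact: diff_derivable (dg x Ux)].
Qed.

Lemma is_CkM k U f g : open U ->
  is_Ck k U f -> is_Ck k U g -> is_Ck k U (fun x => f x * g x).
Proof.
move=> oU; elim: k f g => [|k IH] f g.
  by move=> cf cg x Ux; apply: continuousM; [exact: cf|exact: cg].
move=> Cf Cg; have [[df Df] [dg Dg]] := (Cf, Cg); split=> [x Ux|v].
  by apply: differentiableM; [exact: df|exact: dg].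
apply: is_Ck_eq (is_CkD oU (IH _ _ (is_CkS Cf) (Dg v)) (IH _ _ (is_CkS Cg) (Df v))).
  by [].
by move=> x Ux; rewrite -deriveM; [|exact: diff_derivable (df x Ux)|exact: diff_derivable (dg x Ux)].
Qed.

End SmoothFunctions.

Definition is_smooth (R : realType) (n : nat) (M : manifold R n) (f : M -> R) :=
  forall i, is_Coo (mcoord i @` mdom i) (f \o @mparam R n M i).

Record smoothfun (R : realType) (n : nat) (M : manifold R n) := Smoothfun {
  sfun_val :> M -> R ;
  sfun_smooth : is_smooth sfun_val }.

Section SmoothFunctionAlgebra.
Context {R : realType} {n : nat} {M : manifold R n}.
Implicit Types f g h : smoothfun M.

Lemma sfunP f g : (forall p, f p = g p) -> f = g.
Proof.
case: f g => [f Cf] [g Cg] /= /funext fg; case: _ / fg Cg => Cg.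
by congr Smoothfun; exact: Prop_irrelevance.
Qed.

Lemma is_smooth_cst (c : R) : is_smooth (fun _ : M => c).
Proof. by move=> i k; exact/is_Ck_cst/mimage_open. Qed.

Lemma is_smoothD (f g : M -> R) :
  is_smooth f -> is_smooth g -> is_smooth (fun p => f p + g p).
Proof.
by move=> Cf Cg i k; apply: is_CkD (Cf i k) (Cg i k); exact: mimage_open.
Qed.

Lemma is_smoothM (f g : M -> R) :
  is_smooth f -> is_smooth g -> is_smooth (fun p => f p * g p).
Proof.
by move=> Cf Cg i k; apply: is_CkM (Cf i k) (Cg i k); exact: mimage_open.
Qed.

Lemma is_smoothZ (c : R) (f : M -> R) :
  is_smooth f -> is_smooth (fun p => c * f p).
Proof. by move=> Cf; apply: is_smoothM => //; exact: is_smooth_cst. Qed.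

Lemma is_smoothN (f : M -> R) : is_smooth f -> is_smooth (fun p => - f p).
Proof.
move=> /(is_smoothZ (-1)); congr is_smooth.
by apply/funext => p; rewrite mulN1r.
Qed.

Definition sfun_cst c : smoothfun M := Smoothfun (is_smooth_cst c).
Definition sfun_add f g :=
  Smoothfun (is_smoothD (sfun_smooth f) (sfun_smooth g)).
Definition sfun_mul f g :=
  Smoothfun (is_smoothM (sfun_smooth f) (sfun_smooth g)).
Definition sfun_opp f := Smoothfun (is_smoothN (sfun_smooth f)).
Definition sfun_scale c f := Smoothfun (is_smoothZ c (sfun_smooth f)).

HB.instance Definition _ := gen_eqMixin (smoothfun M).
HB.instance Definition _ := gen_choiceMixin (smoothfun M).

Fact sfun_addA : associative sfun_add.
Proof. by move=> f g h; apply: sfunP => p /=; rewrite addrA. Qed.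
Fact sfun_addC : commutative sfun_add.
Proof. by move=> f g; apply: sfunP => p /=; rewrite addrC. Qed.
Fact sfun_add0 : left_id (sfun_cst 0) sfun_add.
Proof. by move=> f; apply: sfunP => p /=; rewrite add0r. Qed.
Fact sfun_addN : left_inverse (sfun_cst 0) sfun_opp sfun_add.
Proof. by move=> f; apply: sfunP => p /=; rewrite addNr. Qed.
HB.instance Definition _ := GRing.isZmodule.Build (smoothfun M)
  sfun_addA sfun_addC sfun_add0 sfun_addN.

Fact sfun_mulA : associative sfun_mul.
Proof. by move=> f g h; apply: sfunP => p /=; rewrite mulrA. Qed.
Fact sfun_mulC : commutative sfun_mul.
Proof. by move=> f g; apply: sfunP => p /=; rewrite mulrC. Qed.
Fact sfun_mul1 : left_id (sfun_cst 1) sfun_mul.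
Proof. by move=> f; apply: sfunP => p /=; rewrite mul1r. Qed.
Fact sfun_mulDl : left_distributive sfun_mul sfun_add.
Proof. by move=> f g h; apply: sfunP => p /=; rewrite mulrDl. Qed.
HB.instance Definition _ := GRing.Zmodule_isComPzRing.Build (smoothfun M)
  sfun_mulA sfun_mulC sfun_mul1 sfun_mulDl.

Fact sfun_scaleA a b f : sfun_scale a (sfun_scale b f) = sfun_scale (a * b) f.
Proof. by apply: sfunP => p /=; rewrite mulrA. Qed.
Fact sfun_scale1 : left_id 1 sfun_scale.
Proof. by move=> f; apply: sfunP => p /=; rewrite mul1r. Qed.
Fact sfun_scaleDr : right_distributive sfun_scale +%R.
Proof. by move=> a f g; apply: sfunP => p /=; rewrite mulrDr. Qed.
Fact sfun_scaleDl f : {morph sfun_scale^~ f : a b / a + b}.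
Proof. by move=> a b; apply: sfunP => p /=; rewrite mulrDl. Qed.
HB.instance Definition _ := GRing.Zmodule_isLmodule.Build R (smoothfun M)
  sfun_scaleA sfun_scale1 sfun_scaleDr sfun_scaleDl.

Lemma sfunDE f g p : (f + g) p = f p + g p. Proof. by []. Qed.
Lemma sfunNE f p : (- f) p = - f p. Proof. by []. Qed.
Lemma sfunME f g p : (f * g) p = f p * g p. Proof. by []. Qed.
Lemma sfunZE c f p : (c *: f) p = c * f p. Proof. by []. Qed.

End SmoothFunctionAlgebra.

(* Tangent vectors are derivations at a point. *)
Record tangent (R : realType) (n : nat) (M : manifold R n) (p : M) := Tangent {
  tan_val :> smoothfun M -> R ;
  tan_linear : forall a f g, tan_val (a *: f + g) = a * tan_val f + tan_val g ;
  tan_leibniz : forall f g, tan_val (f * g) = f p * tan_val g + g p * tan_val f }.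

Section TangentSpace.
Context {R : realType} {n : nat} {M : manifold R n} {p : M}.
Implicit Types u v w : tangent p.

Lemma tanP u v : (forall f, u f = v f) -> u = v.
Proof.
case: u v => [u lu du] [v lv dv] /= /funext uv; case: _ / uv lv dv => lv dv.
by congr Tangent; exact: Prop_irrelevance.
Qed.

Definition tan_zero : tangent p.
Proof.
by exists (fun=> 0) => [a f g|f g]; rewrite !mulr0 addr0.
Defined.

Definition tan_opp u : tangent p.
Proof.
exists (fun f => - u f) => [a f g|f g].
  by rewrite tan_linear opprD mulrN.
by rewrite tan_leibniz opprD !mulrN.
Defined.

Definition tan_add u v : tangent p.
Proof.
exists (fun f => u f + v f) => [a f g|f g].
  by rewrite !tan_linear mulrDr addrACA.
by rewrite !tan_leibniz !mulrDr addrACA.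
Defined.

Definition tan_scale (c : R) u : tangent p.
Proof.
exists (fun f => c * u f) => [a f g|f g].
  by rewrite tan_linear mulrDr mulrCA.
by rewrite tan_leibniz mulrDr !(mulrCA c).
Defined.

HB.instance Definition _ := gen_eqMixin (tangent p).
HB.instance Definition _ := gen_choiceMixin (tangent p).

Fact tan_addA : associative tan_add.
Proof. by move=> u v w; apply: tanP => f /=; rewrite addrA. Qed.
Fact tan_addC : commutative tan_add.
Proof. by move=> u v; apply: tanP => f /=; rewrite addrC. Qed.
Fact tan_add0 : left_id tan_zero tan_add.
Proof. by move=> u; apply: tanP => f /=; rewrite add0r. Qed.
Fact tan_addN : left_inverse tan_zero tan_opp tan_add.
Proof. by move=> u; apply: tanP => f /=; rewrite addNr. Qed.
HB.instance Definition _ := GRing.isZmodule.Build (tangent p)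
  tan_addA tan_addC tan_add0 tan_addN.

Fact tan_scaleA a b u : tan_scale a (tan_scale b u) = tan_scale (a * b) u.
Proof. by apply: tanP => f /=; rewrite mulrA. Qed.
Fact tan_scale1 : left_id 1 tan_scale.
Proof. by move=> u; apply: tanP => f /=; rewrite mul1r. Qed.
Fact tan_scaleDr : right_distributive tan_scale +%R.
Proof. by move=> a u v; apply: tanP => f /=; rewrite mulrDr. Qed.
Fact tan_scaleDl u : {morph tan_scale^~ u : a b / a + b}.
Proof. by move=> a b; apply: tanP => f /=; rewrite mulrDl. Qed.
HB.instance Definition _ := GRing.Zmodule_isLmodule.Build R (tangent p)
  tan_scaleA tan_scale1 tan_scaleDr tan_scaleDl.

Lemma tanDE u v f : (u + v) f = u f + v f. Proof. by []. Qed.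
Lemma tanNE u f : (- u) f = - u f. Proof. by []. Qed.
Lemma tanZE c u f : (c *: u) f = c * u f. Proof. by []. Qed.

End TangentSpace.

Record vfield (R : realType) (n : nat) (M : manifold R n) := Vfield {
  vf_val :> forall p : M, tangent p ;
  vf_smooth : forall f : smoothfun M, is_smooth (fun p => vf_val p f) }.

Section VectorFields.
Context {R : realType} {n : nat} {M : manifold R n}.
Implicit Types (X Y Z : vfield M) (f g : smoothfun M).

Lemma vfP X Y : (forall p, X p = Y p) -> X = Y.
Proof.
case: X Y => [X CX] [Y CY] /= XY.
have {}XY : X = Y by apply: functional_extensionality_dep.
by case: _ / XY CY => CY; congr Vfield; exact: Prop_irrelevance.
Qed.

Definition vf_zero : vfield M.
Proof. by exists (fun p => 0) => f; exact: is_smooth_cst. Defined.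

Definition vf_opp X : vfield M.
Proof.
by exists (fun p => - X p) => f; exact/is_smoothN/vf_smooth.
Defined.

Definition vf_add X Y : vfield M.
Proof.
by exists (fun p => X p + Y p) => f; apply: is_smoothD; exact: vf_smooth.
Defined.

Definition vf_scale f X : vfield M.
Proof.
exists (fun p => f p *: X p) => g.
by apply: is_smoothM; [exact: sfun_smooth | exact: vf_smooth].
Defined.

HB.instance Definition _ := gen_eqMixin (vfield M).
HB.instance Definition _ := gen_choiceMixin (vfield M).

Fact vf_addA : associative vf_add.
Proof. by move=> X Y Z; apply: vfP => p /=; rewrite addrA. Qed.
Fact vf_addC : commutative vf_add.
Proof. by move=> X Y; apply: vfP => p /=; rewrite addrC. Qed.
Fact vf_add0 : left_id vf_zero vf_add.
Proof. by move=> X; apply: vfP => p /=; rewrite add0r. Qed.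
Fact vf_addN : left_inverse vf_zero vf_opp vf_add.
Proof. by move=> X; apply: vfP => p /=; rewrite addNr. Qed.
HB.instance Definition _ := GRing.isZmodule.Build (vfield M)
  vf_addA vf_addC vf_add0 vf_addN.

Fact vf_scaleA f g X : vf_scale f (vf_scale g X) = vf_scale (f * g) X.
Proof. by apply: vfP => p /=; rewrite scalerA. Qed.
Fact vf_scale1 : left_id 1 vf_scale.
Proof. by move=> X; apply: vfP => p /=; rewrite scale1r. Qed.
Fact vf_scaleDr : right_distributive vf_scale +%R.
Proof. by move=> f X Y; apply: vfP => p /=; rewrite scalerDr. Qed.
Fact vf_scaleDl X : {morph vf_scale^~ X : f g / f + g}.
Proof. by move=> f g; apply: vfP => p /=; rewrite scalerDl. Qed.
HB.instance Definition _ :=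
  GRing.Zmodule_isLmodule.Build (smoothfun M) (vfield M)
  vf_scaleA vf_scale1 vf_scaleDr vf_scaleDl.

Lemma vfDE X Y p : (X + Y) p = X p + Y p. Proof. by []. Qed.
Lemma vfNE X p : (- X) p = - X p. Proof. by []. Qed.
Lemma vfZE f X p : (f *: X) p = f p *: X p. Proof. by []. Qed.

Definition vf_deriv X f : smoothfun M := Smoothfun (vf_smooth X f).

Lemma vf_deriv_linear X a f g :
  vf_deriv X (a *: f + g) = a *: vf_deriv X f + vf_deriv X g.
Proof. by apply: sfunP => p /=; rewrite tan_linear. Qed.

Lemma vf_deriv_leibniz X f g :
  vf_deriv X (f * g) = f * vf_deriv X g + g * vf_deriv X f.
Proof. by apply: sfunP => p /=; rewrite tan_leibniz. Qed.

Lemma tanD p (u : tangent p) f g : u (f + g) = u f + u g.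
Proof. by rewrite -[f]scale1r tan_linear mul1r scale1r. Qed.

Definition bracket_at X Y (p : M) : tangent p.
Proof.
exists (fun f => X p (vf_deriv Y f) - Y p (vf_deriv X f)) => [a f g|f g].
  by rewrite !vf_deriv_linear !tan_linear mulrBr opprD addrACA.
by rewrite !vf_deriv_leibniz !tanD !tan_leibniz /=; ring.
Defined.

Definition bracket X Y : vfield M.
Proof.
exists (bracket_at X Y) => f /=.
by apply: is_smoothD; [|apply: is_smoothN]; exact: vf_smooth.
Defined.

End VectorFields.

(* Pulling back smooth functions is equivalent to smoothness in charts. *)
Record smoothmap (R : realType) (m n : nat) (M : manifold R m)
    (N : manifold R n) := Smoothmap {
  smap_val :> M -> N ;
  smap_continuous : continuous smap_val ;
  smap_smooth : forall f : smoothfun N, is_smooth (f \o smap_val) }.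

Section SmoothMaps.
Context {R : realType} {m n : nat} {M : manifold R m} {N : manifold R n}.
Implicit Types phi : smoothmap M N.

Definition pullback phi (f : smoothfun N) : smoothfun M :=
  Smoothfun (smap_smooth phi f).

Definition differential phi (p : M) (v : tangent p) : tangent (phi p).
Proof.
exists (fun f => v (pullback phi f)) => [a f g|f g].
  by rewrite -tan_linear; congr (v _); exact: sfunP.
rewrite -[f _]/(pullback phi f p) -[g _]/(pullback phi g p) -tan_leibniz.
by congr (v _); exact: sfunP.
Defined.

Definition is_open_embedding phi : Prop :=
  [/\ injective phi,
      (forall O : set M, open O -> open (phi @` O)) &
      forall p : M, bijective (@differential phi p)].

End SmoothMaps.

Record form1 (R : realType) (n : nat) (M : manifold R n) := Form1 {
  f1_val :> forall p : M, tangent p -> R ;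
  f1_linear : forall p a (u v : tangent p),
    f1_val (a *: u + v) = a * f1_val u + f1_val v ;
  f1_smooth : forall A : vfield M, is_smooth (fun p => f1_val (A p)) }.

Record tensor2 (R : realType) (n : nat) (M : manifold R n) := Tensor2 {
  t2_val :> forall p : M, tangent p -> tangent p -> R ;
  t2_linearl : forall p a (u v w : tangent p),
    t2_val (a *: u + v) w = a * t2_val u w + t2_val v w ;
  t2_linearr : forall p a (u v w : tangent p),
    t2_val u (a *: v + w) = a * t2_val u v + t2_val u w ;
  t2_smooth : forall A B : vfield M, is_smooth (fun p => t2_val (A p) (B p)) }.

Record endofield (R : realType) (n : nat) (M : manifold R n) := Endofield {
  ef_val :> forall p : M, tangent p -> tangent p ;
  ef_linear : forall p a (u v : tangent p),
    ef_val (a *: u + v) = a *: ef_val u + ef_val v ;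
  ef_smooth : forall (A : vfield M) (f : smoothfun M),
    is_smooth (fun p => ef_val (A p) f) }.

Arguments f1_val {R n M} f p v.
Arguments t2_val {R n M} t p u v.
Arguments ef_val {R n M} e p v.

Section Tensors.
Context {R : realType} {n : nat} {M : manifold R n}.
Implicit Types (A B C Z : vfield M) (f : smoothfun M) (eta : form1 M).
Implicit Types (T g : tensor2 M) (I J : endofield M).

Definition f1_app eta A : smoothfun M := Smoothfun (f1_smooth eta A).

Definition t2_app T A B : smoothfun M := Smoothfun (t2_smooth T A B).

Definition ef_app I A : vfield M := Vfield (ef_smooth I A).

Definition ef_id : endofield M.
Proof. by exists (fun p v => v) => // A f; exact: vf_smooth. Defined.

Definition ef_comp I J : endofield M.
Proof.
exists (fun p v => I p (J p v)) => [p a u v|A f]; first by rewrite !ef_linear.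
exact: (ef_smooth I (ef_app J A)).
Defined.

Definition contract Z T : form1 M.
Proof.
exists (fun p v => T p (Z p) v) => [p a u v|A]; first exact: t2_linearr.
exact: t2_smooth.
Defined.

Definition t2_endo g I : tensor2 M.
Proof.
exists (fun p u v => g p (I p u) v) => [p a u v w|p a u v w|A B].
- by rewrite ef_linear t2_linearl.
- exact: t2_linearr.
- exact: (t2_smooth g (ef_app I A) B).
Defined.

(* No factor 1/2 in this convention. *)
Definition ext_d eta A B : smoothfun M :=
  vf_deriv A (f1_app eta B) - vf_deriv B (f1_app eta A)
  - f1_app eta (bracket A B).

Definition lie_tensor2 Z T A B : smoothfun M :=
  vf_deriv Z (t2_app T A B) - t2_app T (bracket Z A) B
  - t2_app T A (bracket Z B).

Definition is_metric g : Prop :=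
  (forall p (u v : tangent p), g p u v = g p v u) /\
  (forall p (u : tangent p), (forall v, g p u v = 0) -> u = 0).

End Tensors.

Record connection (R : realType) (n : nat) (M : manifold R n) := Connection {
  conn_val :> vfield M -> vfield M -> vfield M ;
  conn_linear : forall (f : smoothfun M) (A B C : vfield M),
    conn_val (f *: A + B) C = f *: conn_val A C + conn_val B C ;
  conn_additive : forall A B C : vfield M,
    conn_val A (B + C) = conn_val A B + conn_val A C ;
  conn_leibniz : forall (f : smoothfun M) (A B : vfield M),
    conn_val A (f *: B) = vf_deriv A f *: B + f *: conn_val A B }.

Section Connections.
Context {R : realType} {n : nat} {M : manifold R n}.
Implicit Types (D : connection M) (g : tensor2 M) (I : endofield M).

Definition is_levi_civita g D : Prop :=
  (forall A B C, vf_deriv A (t2_app g B C) =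
                 t2_app g (D A B) C + t2_app g B (D A C)) /\
  (forall A B, D A B - D B A = bracket A B).

Definition is_parallel D I : Prop :=
  forall A B, D A (ef_app I B) = ef_app I (D A B).

Definition invariant_vf (Z A : vfield M) : Prop := bracket Z A = 0.

Definition invariant_conn (Z : vfield M) D : Prop :=
  forall A B, bracket Z (D A B) = D (bracket Z A) B + D A (bracket Z B).

End Connections.

Section Flows.
Context {R : realType} {n : nat} {M : manifold R n}.
Implicit Types (Z : vfield M).

Definition integral_at Z (c : R -> M) (t : R) : Prop :=
  forall f : smoothfun M, is_derive t 1 (f \o c) (Z (c t) f).

Definition same_orbit Z (p q : M) : Prop :=
  exists (c : R -> M) (a b : R), [/\ c a = p, c b = q &
    forall t, Num.min a b <= t <= Num.max a b -> integral_at Z c t].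

(* [Z] generates a free action of the circle R / T Z for some period T > 0.
   Joint smoothness of the action in (t, p) is automatic, since [psi] is the flow
   of the smooth vector field [Z]. *)
Definition generates_free_circle_action Z : Prop :=
  exists (T : R) (psi : R -> smoothmap M M),
    [/\ 0 < T,
        forall p, psi 0 p = p,
        forall s t p, psi (s + t) p = psi s (psi t p),
        forall p t, integral_at Z (fun s => psi s p) t &
        forall p t, psi t p = p <-> exists k : int, t = k%:~R * T].

End Flows.

(* [pi] exhibits [N] as the quotient of [M] by the flow of [X]: it is a surjective
   submersion whose fibres are the orbits, so that its vertical spaces are spanned
   by [X]. *)
Definition is_orbit_space (R : realType) (m n : nat) (M : manifold R m)
    (N : manifold R n) (X : vfield M) (pi : smoothmap M N) : Prop :=
  [/\ forall y, exists p, pi p = y,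
      forall p (w : tangent (pi p)), exists v, differential pi v = w,
      forall p (v : tangent p),
        differential pi v = 0 <-> exists a, v = a *: X p &
      forall p q, pi p = pi q <-> same_orbit X p q].

Definition is_parallel_complex (R : realType) (n : nat) (M : manifold R n)
    (g : tensor2 M) (D : connection M) (I : endofield M) : Prop :=
  [/\ forall p (v : tangent p), I p (I p v) = - v,
      forall p (u v : tangent p), g p (I p u) (I p v) = g p u v &
      is_parallel D I].

Section HyperKaehler.
Context {R : realType} {n : nat} {N : manifold R n}.
Variables (g : tensor2 N) (D : connection N) (I1 I2 I3 : endofield N).
Variables (Z : vfield N) (fZ : smoothfun N).

Definition quat (mu : 'I_4) : endofield N := nth ef_id [:: ef_id; I1; I2; I3] mu.

Definition omega (mu : 'I_4) : tensor2 N := t2_endo g (quat mu).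

Definition alpha (mu : 'I_4) : form1 N := contract Z (omega mu).

Definition is_hyperkaehler : Prop :=
  [/\ is_metric g /\ is_levi_civita g D,
      [/\ is_parallel_complex g D I1, is_parallel_complex g D I2 &
          is_parallel_complex g D I3],
      forall p (v : tangent p), I1 p (I2 p v) = I3 p v &
      forall p (v : tangent p), I2 p (I1 p v) = - I3 p v].

Definition is_rotating : Prop :=
  [/\ forall A B, lie_tensor2 Z g A B = 0,
      forall A B, lie_tensor2 Z (t2_endo g I1) A B = 0,
      forall A B, lie_tensor2 Z (t2_endo g I2) A B = t2_app (t2_endo g I3) A B &
      forall A B, lie_tensor2 Z (t2_endo g I3) A B = - t2_app (t2_endo g I2) A B].

Definition is_moment_map : Prop :=
  forall p (v : tangent p), contract Z (t2_endo g I1) p v = - v fZ.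

Definition fH : smoothfun N := fZ + t2_app g Z Z.

Definition is_omegaH (omegaH : tensor2 N) : Prop :=
  forall A B, t2_app omegaH A B =
    t2_app (t2_endo g I1) A B + ext_d (contract Z g) A B.

Definition IH (A : vfield N) : vfield N := ef_app I1 A + D A Z *+ 2.

Definition gH (p : N) (u v : tangent p) : R :=
  (fZ p)^-1 * g p u v +
  (fZ p)^-2 * \sum_(mu < 4) alpha mu p u * alpha mu p v.

Definition S_at (A B : vfield N) (p : N) : tangent p :=
  2^-1 *: \sum_(mu < 4)
    (((fH p)^-1 * g p (quat mu p (IH A p)) (B p)) *: quat mu p (Z p)
     - (fZ p)^-1 *: (alpha mu p (A p) *: quat mu p (I1 p (B p))
                     + alpha mu p (B p) *: quat mu p (I1 p (A p)))).

End HyperKaehler.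

(* The principal circle bundle [tw_P] and the twist [tw_Nbar].  The open
   submanifold [tw_U] of [tw_P], embedded by [tw_j], allows for the case where the
   space of [Z_P]-orbits is only locally a manifold; globally [tw_U = tw_P]. *)
Record twist (R : realType) (n : nat) (N : manifold R n) (Z : vfield N)
    (wH : tensor2 N) (f : smoothfun N) := Twist {
  tw_P : manifold R n.+1 ;
  tw_pi : smoothmap tw_P N ;
  tw_X : vfield tw_P ;
  tw_free : generates_free_circle_action tw_X ;
  tw_principal : is_orbit_space tw_X tw_pi ;
  tw_eta : form1 tw_P ;
  tw_eta_X : forall q, tw_eta q (tw_X q) = 1 ;
  tw_curvature : forall (A B : vfield tw_P) q, ext_d tw_eta A B q =
    wH (tw_pi q) (differential tw_pi (A q)) (differential tw_pi (B q)) ;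
  tw_ZP : vfield tw_P ;
  tw_ZPE : forall q, exists h : tangent q,
    [/\ tw_eta q h = 0, differential tw_pi h = Z (tw_pi q) &
        tw_ZP q = h + f (tw_pi q) *: tw_X q] ;
  tw_U : manifold R n.+1 ;
  tw_j : smoothmap tw_U tw_P ;
  tw_j_open : is_open_embedding tw_j ;
  tw_ZU : vfield tw_U ;
  tw_ZUE : forall u, differential tw_j (tw_ZU u) = tw_ZP (tw_j u) ;
  tw_Nbar : manifold R n ;
  tw_pibar : smoothmap tw_U tw_Nbar ;
  tw_quotient : is_orbit_space tw_ZU tw_pibar }.

Section HRelated.
Context {R : realType} {n : nat} {N : manifold R n} {Z : vfield N}.
Context {wH : tensor2 N} {f : smoothfun N} (t : twist Z wH f).

Definition horizontal (u : tw_U t) (h : tangent u) : Prop :=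
  tw_eta t (tw_j t u) (differential (tw_j t) h) = 0.

Definition to_base (u : tw_U t) (h : tangent u) : tangent (tw_pi t (tw_j t u)) :=
  differential (tw_pi t) (differential (tw_j t) h).

Definition to_twist (u : tw_U t) (h : tangent u) : tangent (tw_pibar t u) :=
  differential (tw_pibar t) h.

Definition hrel_tensor2 (T : forall p : N, tangent p -> tangent p -> R)
    (T' : tensor2 (tw_Nbar t)) : Prop :=
  forall u (h k : tangent u), horizontal h -> horizontal k ->
    T _ (to_base h) (to_base k) = T' _ (to_twist h) (to_twist k).

Definition hrel_vf (A : vfield N) (A' : vfield (tw_Nbar t)) : Prop :=
  invariant_vf Z A /\
  forall u, exists h : tangent u, [/\ horizontal h,
    to_base h = A (tw_pi t (tw_j t u)) & to_twist h = A' (tw_pibar t u)].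

Definition hrel_conn (D : connection N) (D' : connection (tw_Nbar t)) : Prop :=
  invariant_conn Z D /\
  forall A A' B B', hrel_vf A A' -> hrel_vf B B' -> hrel_vf (D A B) (D' A' B').

End HRelated.

(* Main.v *)
Require Import Defs.
From HB Require Import structures.
From mathcomp Require Import all_boot all_order all_algebra.
From mathcomp Require Import all_classical all_reals all_analysis.
From mathcomp Require Import ring lra.

Set Implicit Arguments.
Unset Strict Implicit.
Unset Printing Implicit Defensive.

Import Order.TTheory GRing.Theory Num.Theory.
Import numFieldNormedType.Exports.

Local Open Scope classical_set_scope.
Local Open Scope ring_scope.

(* Let T be the vector-valued 2-form (omega_H / f_H) Z.  A horizontal lift V of a
   Z-invariant field A is projectable to the twist, and the bracket of two lifts
   V, W of A, B has vertical component - omega_H(A, B); since Z_P = Z~ + f_H X_P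
   projects to 0, [V, W] projects to the vector H-related to [A, B] + T(A, B).
   Hence the Koszul formula of g_Q, pulled back to the bundle, is the Koszul
   formula on N of the connection that preserves g_H and has torsion T, so the
   theorem reduces to: D + S is metric for g_H and has torsion T.  The torsion
   follows from I_H being skew and commuting with the I_k (the rotating condition
   is L_Z I_1 = 0, L_Z I_2 = I_3, L_Z I_3 = - I_2), the metricity from expanding
   everything in the quaternionic frame, with D_A Z = (I_H A - I_1 A) / 2 and
   |Z|^2 = f_H - f_Z.

   Tangent vectors being derivations of global functions, testing the formula
   against an arbitrary vector requires extending that vector to a field, and
   lifts must be shown smooth.  Both rest on local frames: Hadamard's lemma shows
   that the coordinate derivations, cut off by bump functions, span every tangent
   space in a neighbourhood. *)

(** * Smooth functions on open subsets of R^n *)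

(** The claim compares objects on two manifolds, so the comparison is made at a point [u] of the
    total space. The pulled-back [gQ] is degenerate along the orbits of [Z_P], so nondegeneracy is
    used only on the twist, and every tangent vector there must first be represented by a horizontal
    one. This is possible because [eta(Z_P) = f_H] has no zeros. The obstacle is the third argument
    of the Koszul formula. A field on [N] that extends a given test vector need not be
    [Z]-invariant, so its lift need not project to the twist. The formula is therefore pulled back
    with an arbitrary field in that slot, in which it is tensorial. On [N] the tensor [S] is not
    derived but verified. The summands for [I_2] and [I_3] are not invariant separately, since the
    action rotates them into each other; only their sum is. *)

Lemma ler_coord_norm (R : realType) n (x : 'rV[R]_n) k : `|x 0 k| <= `|x|.
Proof.
rewrite [leRHS]/Num.norm /= mx_normrE.
by apply/bigmax_geP; right => /=; exists (0, k).
Qed.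

Section Differentiability.
Context {R : realType} {n : nat}.
Implicit Types (U W : set 'rV[R]_n) (f g : 'rV[R]_n -> R).

Lemma derive_partial f (a v : 'rV[R]_n) : differentiable f a ->
  'D_v f a = \sum_k v 0 k * 'D_(delta_mx 0 k) f a.
Proof.
move=> df; rewrite deriveE// {1}[v]row_sum_delta linear_sum.
by apply: eq_bigr => k _; rewrite linearZ deriveE.
Qed.

Lemma continuous_row (T : topologicalType) m (F : T -> 'rV[R]_m) (a : T) :
  (forall k, {for a, continuous (fun x => F x 0 k)}) -> {for a, continuous F}.
Proof.
move=> cF.
have -> : F = \sum_(k < m) (fun x => F x 0 k *: delta_mx 0 k).
  by apply/funext => x; rewrite fct_sumE [LHS]row_sum_delta.
elim/big_rec: _ => [|i f _ cf]; first exact: cst_continuous.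
apply: (@continuousD _ _ _ _ f _ _ cf); exact: cvgZr_tmp (cF i).
Qed.

Lemma differentiable_row m (F : 'rV[R]_n -> 'rV[R]_m) (a : 'rV[R]_n) :
  (forall k, differentiable (fun x => F x 0 k) a) -> differentiable F a.
Proof.
move=> dF.
have -> : F = \sum_(k < m) (fun x => F x 0 k *: delta_mx 0 k).
  by apply/funext => x; rewrite fct_sumE [LHS]row_sum_delta.
by apply: differentiable_sum => k; exact: differentiableZl.
Qed.

Lemma derive_row m (F : 'rV[R]_n -> 'rV[R]_m) (a v : 'rV[R]_n) k :
  differentiable F a -> 'D_v F a 0 k = 'D_v (fun x => F x 0 k) a.
Proof.
by move=> dF; rewrite derive_mx ?mxE//; exact: diff_derivable.
Qed.

Lemma is_Ck_sub k U W f : W `<=` U -> is_Ck k U f -> is_Ck k W f.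
Proof.
move=> WU; elim: k f => [|k IH] f /=; first by move=> cf x /WU; exact: cf.
by move=> [df Df]; split=> [x /WU|v]; [exact: df|exact/IH/Df].
Qed.

(** Derivatives are taken in the ambient space, so [is_Ck k [set x] f] depends only on the germ of
    [f] at [x]. Smoothness can thus be checked with a different local expression at each point. *)
Lemma is_CkP k U f : (forall x, U x -> is_Ck k [set x] f) -> is_Ck k U f.
Proof.
elim: k f => [|k IH] f Cf /=; first by move=> x Ux; exact: (Cf x Ux).
split=> [x Ux|v]; first by apply: (Cf x Ux).1.
by apply: IH => x Ux; exact: (Cf x Ux).2.
Qed.

Lemma is_Ck_near k x f g : (\near x, f x = g x) ->
  is_Ck k [set x] f -> is_Ck k [set x] g.
Proof.
elim: k f g => [|k IH] f g fg /=.
  by move=> cf _ ->; exact: near_eq_continuous fg (cf x erefl).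
move=> [df Df]; split=> [_ ->|v].
  exact: near_eq_differentiable fg (df x erefl).
(* Equality near [x] is equality near every point close to [x], so the derivatives agree near [x]
   too. *)
apply: IH (Df v); have := near_join fg; apply: filterS => y.
exact: near_eq_derive.
Qed.

Lemma is_Ck_le k l U f : (k <= l)%N -> is_Ck l U f -> is_Ck k U f.
Proof.
by move=> /subnK <-; elim: (l - k)%N => //= i IH /is_CkS; exact: IH.
Qed.

Lemma is_Ck_coord k U (i : 'I_n) : open U -> is_Ck k U (fun x => x 0 i).
Proof.
move=> oU; case: k => [|k]; first by move=> x _; exact: coord_continuous.
split=> [x _|v]; first exact: differentiable_coord.
have -> : (fun x : 'rV[R]_n => 'D_v (fun y : 'rV[R]_n => y 0 i : R^o) x) = fun=> v 0 i.
  apply/funext => x; rewrite -(@derive_row _ id)//; first by rewrite derive_id.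
exact: is_Ck_cst.
Qed.

Lemma is_Ck_sum k U (I : Type) (r : seq I) (P : pred I) (F : I -> 'rV[R]_n -> R) :
  open U -> (forall i, P i -> is_Ck k U (F i)) ->
  is_Ck k U (fun x => \sum_(i <- r | P i) F i x).
Proof.
move=> oU CF.
have -> : (fun x => \sum_(i <- r | P i) F i x) = \sum_(i <- r | P i) F i.
  by apply/funext => x; rewrite fct_sumE.
elim/big_rec: _ => [|i f Pi Cf]; first exact: is_Ck_cst.
by apply: is_CkD => //; exact: CF.
Qed.

Lemma is_Ck_prod k U (I : Type) (r : seq I) (P : pred I) (F : I -> 'rV[R]_n -> R) :
  open U -> (forall i, P i -> is_Ck k U (F i)) ->
  is_Ck k U (fun x => \prod_(i <- r | P i) F i x).
Proof.
move=> oU CF.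
have -> : (fun x => \prod_(i <- r | P i) F i x) = \prod_(i <- r | P i) F i.
  by apply/funext => x; rewrite fct_prodE.
elim/big_rec: _ => [|i f Pi Cf]; first exact: is_Ck_cst.
by apply: is_CkM => //; exact: CF.
Qed.

Lemma is_CkV k U f : open U -> (forall x, U x -> f x != 0) ->
  is_Ck k U f -> is_Ck k U (fun x => (f x)^-1).
Proof.
move=> oU f0; elim: k => [|k IH] Cf.
  by move=> x Ux; apply: continuousV; [exact: f0|exact: (Cf x Ux)].
have [df Df] := Cf; split=> [x Ux|v].
  by apply: differentiableV; [exact: df|exact: f0].
have IH' := IH (is_CkS Cf).
apply: (@is_Ck_eq _ _ k U (fun x => -1 * ((f x)^-1 * (f x)^-1) * 'D_v f x)) => //.
  move=> x Ux; rewrite [RHS]deriveV; last 2 first.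
  - exact: f0.
  - exact/diff_derivable/df.
  by rewrite /GRing.scale/= -exprVn expr2 mulN1r.
exact: is_CkM oU (is_CkM oU (is_Ck_cst _ _ oU) (is_CkM oU IH' IH')) (Df v).
Qed.

End Differentiability.

Lemma is_Ck_comp (R : realType) m n k (U : set 'rV[R]_m) (W : set 'rV[R]_n)
    (f : 'rV[R]_n -> R) (F : 'rV[R]_m -> 'rV[R]_n) :
  open U -> (forall x, U x -> W (F x)) ->
  (forall i, is_Ck k U (fun x => F x 0 i)) -> is_Ck k W f ->
  is_Ck k U (f \o F).
Proof.
move=> oU UW; elim: k f => [|k IH] f CF Cf.
  move=> x Ux; apply: continuous_comp; last exact/Cf/UW.
  by apply: continuous_row => i; exact: (CF i x).
have dF x : U x -> differentiable F x.
  by move=> Ux; apply: differentiable_row => i; apply: (CF i).1.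
split=> [x Ux|v].
  by apply: differentiable_comp; [exact: dF|exact/Cf.1/UW].
apply: (@is_Ck_eq _ _ _ U (fun x => \sum_i
    'D_v (fun x => F x 0 i) x * ('D_(delta_mx 0 i) f \o F) x)) => //.
  move=> x Ux; have Wx := Cf.1 _ (UW _ Ux).
  rewrite [RHS]deriveE; last by apply: differentiable_comp => //; exact: dF.
  rewrite diff_comp//=; last exact: dF.
  rewrite -!deriveE//; last exact: dF.
  rewrite (derive_partial _ Wx); apply: eq_bigr => i _.
  by rewrite derive_row//; exact: dF.
apply: is_Ck_sum => // i _; apply: is_CkM => //; first exact: (CF i).2.
by apply: IH (Cf.2 _) => j; exact/is_CkS.
Qed.

(** * Bump functions *)

Section Flat.
Context {R : realType}.
Implicit Types (P : {poly R}) (t : R).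

(* Functions of this shape are closed under differentiation. *)
Definition flat P t : R := if 0 < t then P.[t^-1] * expR (- t^-1) else 0.

(** Termwise [s ^+ i * expR (- s) <= i!], because [s ^+ i / i!] is a term of the exponential
    series. *)
Lemma poly_expR_bounded P :
  exists2 C : R, 0 <= C & forall s, 0 <= s -> `|P.[s] * expR (- s)| <= C.
Proof.
exists (\sum_(i < size P) `|P`_i| * i`!%:R) => [|s s0].
  by apply: sumr_ge0 => i _; rewrite mulr_ge0.
rewrite horner_coef mulr_suml (le_trans (ler_norm_sum _ _ _))//.
apply: ler_sum => i _; rewrite -mulrA normrM ler_wpM2l// normrM.
rewrite ger0_norm ?exprn_ge0// (ger0_norm (expR_ge0 _)) expRN.
rewrite ler_pdivrMr ?expR_gt0//.
case: (i : nat) => [|k].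
  rewrite expr0 fact0 mul1r (le_trans _ (expR_ge1Dx _))// lerDl//.
rewrite -ler_pdivrMl ?ltr0n ?fact_gt0// mulrC.
by apply: le_trans (expR_ge1Dxn k s0); rewrite lerDr.
Qed.

Lemma is_derive_quadratic (f : R -> R) (C : R) :
  (forall h, `|f h| <= C * h ^+ 2) -> is_derive (0 : R) 1 f 0.
Proof.
move=> fC; have f0 : f 0 = 0.
  by apply/normr0_eq0/le_anti; rewrite normr_ge0 andbT (le_trans (fC 0))// expr0n mulr0.
have C0 : 0 <= C by have := fC 1; rewrite expr1n mulr1; exact: le_trans.
suff H : h^-1 *: ((f \o shift 0) (h *: 1) - f 0) @[h --> (0:R)^'] --> (0 : R).
  by apply: DeriveDef; [apply/cvg_ex; exists 0|exact: cvg_lim H].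
apply/cvgr0Pnorm_le => e e0.
(* [C + 1] is positive even when [C = 0]. *)
exists (e / (C + 1)) => /=; first by rewrite divr_gt0// ltr_wpDl.
move=> h /=; rewrite sub0r normrN => he h0.
rewrite f0 subr0 addr0 [h *: 1]mulr1 normrM normfV ler_pdivrMl ?normr_gt0//.
apply: (le_trans (fC h)); rewrite -real_normK ?num_real// expr2 mulrA mulrC.
rewrite ler_wpM2l//; move: he; rewrite ltr_pdivlMr ?ltr_wpDl// => /ltW.
by apply: le_trans; rewrite mulrC ler_wpM2l// lerDl.
Qed.

Lemma flat_quadratic P : exists C : R, forall t, `|flat P t| <= C * t ^+ 2.
Proof.
(* Evaluated at [t^-1], the factor ['X^2] yields the [t ^+ 2] of the bound. *)
have [C C0 HC] := poly_expR_bounded (P * 'X^2).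
exists C => t; rewrite /flat; case: ifP => t0; last first.
  by rewrite normr0 mulr_ge0// sqr_ge0.
have := HC t^-1; rewrite invr_ge0 => /(_ (ltW t0)).
rewrite hornerM hornerXn -ler_pdivrMr ?exprn_gt0//.
apply: le_trans; rewrite -[leLHS]ger0_norm ?divr_ge0 ?sqr_ge0//.
by rewrite normrM normr_id -normrM exprVn mulrAC.
Qed.

(** With [s = 1 / t], the derivative of [P(s) e^(-s)] in [t] is [s^2 (P(s) - P'(s)) e^(-s)]. At [0],
    quadratic decay gives differentiability with derivative [0]. *)
Lemma is_derive_flat P t :
  is_derive t 1 (flat P) (flat ('X^2 * (P - P^`())) t).
Proof.
have [t0|t0|->] := ltgtP t 0.
- rewrite /flat ltNge (ltW t0)/=; apply: near_eq_is_derive (is_derive_cst 0 t 1).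
  near=> s; rewrite ltNge ltW//; near: s; exact: lt_nbhsl.
- pose H (s : R) := P.[s] * expR (- s).
  have dH : is_derive t^-1 1 H (expR (- t^-1) * P^`().[t^-1] - P.[t^-1] * expR (- t^-1)).
    apply: is_derive_eq; rewrite /GRing.scale/=; ring.
  have dV : is_derive t 1 (fun s : R => s^-1) (- t ^- 2 *: 1).
    by apply: is_deriveV; rewrite gt_eqF.
  have := is_derive1_comp dH dV.
  rewrite {2}/flat t0.
  set a := (X in is_derive _ _ _ X); set b := (X in _ -> is_derive _ _ _ X).
  have -> : a = b.
    by rewrite /a /b !hornerE /GRing.scale/= exprVn; ring.
  apply: near_eq_is_derive.
  near=> s; rewrite /flat ifT//; near: s; exact: lt_nbhsr.
- have [C HC] := flat_quadratic P.
  by rewrite {2}/flat ltxx; exact: is_derive_quadratic HC.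
Unshelve. all: by end_near. Qed.

Lemma is_Ck_flat n k U P (f : 'rV[R]_n -> R) : open U ->
  is_Ck k U f -> is_Ck k U (fun x => flat P (f x)).
Proof.
move=> oU; elim: k P => [|k IH] P Cf.
  move=> x Ux; apply: continuous_comp; first exact: (Cf x Ux).
  apply/differentiable_continuous/derivable1_diffP.
  by have [] := is_derive_flat P (f x).
have dP y : differentiable (flat P : R -> R^o) y.
  by apply/derivable1_diffP; have [] := is_derive_flat P y.
split=> [x Ux|v]; first by apply: differentiable_comp; [exact: Cf.1|exact: dP].
apply: (@is_Ck_eq _ _ k U
  (fun x => 'D_v f x * flat ('X^2 * (P - P^`())) (f x))) => //; last first.
  by apply: is_CkM => //; [exact: Cf.2|exact/IH/is_CkS].
move=> x Ux; have dfx := Cf.1 _ Ux.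
rewrite [RHS]deriveE; last exact: differentiable_comp.
rewrite diff_comp//= diff1E//= -deriveE// derive1E /GRing.scale/=; congr (_ * _).
by have := is_derive_flat P (f x) => ?; rewrite derive_val.
Qed.

Definition smooth_step t : R := flat 1 t / (flat 1 t + flat 1 (1 - t)).

Lemma flat1_ge0 t : 0 <= flat 1 t.
Proof. by rewrite /flat hornerC mul1r; case: ifP => // _; exact: expR_ge0. Qed.

Lemma flat1_gt0 t : 0 < t -> 0 < flat 1 t.
Proof. by rewrite /flat hornerC mul1r => ->; exact: expR_gt0. Qed.

Lemma smooth_step_den t : 0 < flat 1 t + flat 1 (1 - t).
Proof.
have [t0|t0] := ltP 0 t; first by rewrite ltr_wpDr ?flat1_ge0 ?flat1_gt0.
by rewrite ltr_wpDl ?flat1_ge0// flat1_gt0// subr_gt0 (le_lt_trans t0).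
Qed.

Lemma smooth_step0 t : t <= 0 -> smooth_step t = 0.
Proof. by move=> t0; rewrite /smooth_step {1}/flat ltNge t0 mul0r. Qed.

Lemma smooth_step1 t : 1 <= t -> smooth_step t = 1.
Proof.
move=> t1; rewrite /smooth_step {3}/flat subr_gt0 ltNge t1 addr0 divff//.
by rewrite gt_eqF// flat1_gt0// (lt_le_trans _ t1).
Qed.

(** The product over coordinates matches the supremum norm of row vectors, and the square keeps the
    factors smooth. For [x] a rescaled coordinate, [2 - x ^+ 2] is at least [1] if [|x| <= 1] and
    negative if [|x| >= 2]. *)
Definition box_bump n (c : 'rV[R]_n) (r : R) (y : 'rV[R]_n) : R :=
  \prod_(k < n) smooth_step (2 - ((y 0 k - c 0 k) / r) ^+ 2).

Lemma is_Coo_box_bump n (c : 'rV[R]_n) (r : R) U : open U -> is_Coo U (box_bump c r).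
Proof.
move=> oU k; apply: is_Ck_prod => // i _; rewrite /smooth_step.
have Cf : is_Ck k U (fun y : 'rV[R]_n => 2 - ((y 0 i - c 0 i) / r) ^+ 2).
  have C1 : is_Ck k U (fun y : 'rV[R]_n => (y 0 i - c 0 i) / r).
    by apply: (is_CkM oU (is_CkD oU _ _)); [exact: is_Ck_coord| |]; exact: is_Ck_cst.
  have -> : (fun y : 'rV[R]_n => 2 - ((y 0 i - c 0 i) / r) ^+ 2) =
      (fun y => 2 + -1 * (((y 0 i - c 0 i) / r) * ((y 0 i - c 0 i) / r))).
    by apply/funext => y; rewrite mulN1r expr2.
  apply: (is_CkD oU); first exact: is_Ck_cst.
  by apply: (is_CkM oU); [exact: is_Ck_cst|exact: is_CkM].
have C1 := is_Ck_flat 1 oU Cf; apply: (is_CkM oU C1).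
apply: is_CkV => // [x _|]; first by rewrite gt_eqF// smooth_step_den.
apply: (is_CkD oU C1); apply: is_Ck_flat => //.
have /(is_CkM oU (is_Ck_cst k (-1) oU)) := Cf.
move=> /(is_CkD oU (is_Ck_cst k 1 oU)); apply: is_Ck_eq => // x _.
by rewrite mulN1r.
Qed.

Lemma box_bump1 n (c : 'rV[R]_n) (r : R) y : 0 < r ->
  `|y - c| <= r -> box_bump c r y = 1.
Proof.
move=> r0 yc; rewrite /box_bump big1// => k _; apply: smooth_step1.
have : `|(y - c) 0 k| <= r by apply: le_trans yc; exact: ler_coord_norm.
rewrite !mxE => ykr.
suff : ((y 0 k - c 0 k) / r) ^+ 2 <= 1 by lra.
by rewrite -real_normK ?num_real// expr_le1// normrM normfV (gtr0_norm r0) ler_pdivrMr// mul1r.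
Qed.

Lemma box_bump0 n (c : 'rV[R]_n) (r : R) y : 0 < r ->
  r *+ 2 <= `|y - c| -> box_bump c r y = 0.
Proof.
move=> r0 yc.
have : exists k, r *+ 2 <= `|(y - c) 0 k|.
  (* A nonzero norm is attained by a coordinate; positivity also rules out [n = 0]. *)
  have /mx_norm_neq0[[i k] /= E] : mx_norm (y - c) != 0.
    by rewrite gt_eqF//; apply: lt_le_trans yc; rewrite pmulrn_lgt0.
  by exists k; rewrite -(ord1 i) -E.
move=> [k]; rewrite !mxE => ykr; rewrite /box_bump (bigD1 k)//= smooth_step0 ?mul0r//.
suff : 2 ^+ 2 <= ((y 0 k - c 0 k) / r) ^+ 2 by lra.
rewrite -[leRHS]real_normK ?num_real// lerXn2r ?nnegrE//.
by rewrite normrM normfV (gtr0_norm r0) ler_pdivlMr// mulr_natl.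
Qed.

End Flat.

(** * Hadamard's lemma *)

Section UnitIntegral.
Context {R : realType}.
Implicit Types f g : R -> R.

Definition continuous01 f := forall t, 0 <= t <= 1 -> {for t, continuous f}.

Definition integral01 f : R := Rintegral (@lebesgue_measure R) `[0, 1] f.

Lemma integrable01 f : continuous01 f ->
  (@lebesgue_measure R).-integrable `[0, 1] (EFin \o f).
Proof.
move=> cf; apply: continuous_compact_integrable; first exact: segment_compact.
apply: continuous_in_subspaceT => t; rewrite inE/= in_itv/= => t01; exact: cf.
Qed.

Lemma integral01D f g : continuous01 f -> continuous01 g ->
  integral01 (fun t => f t + g t) = integral01 f + integral01 g.
Proof. by move=> cf cg; rewrite /integral01 RintegralD//; exact: integrable01. Qed.

Lemma integral01Z (c : R) f : continuous01 f ->
  integral01 (fun t => c * f t) = c * integral01 f.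
Proof. by move=> cf; rewrite /integral01 RintegralZl//; exact: integrable01. Qed.

Lemma continuous01D f g : continuous01 f -> continuous01 g ->
  continuous01 (fun t => f t + g t).
Proof. by move=> cf cg t t01; apply: continuousD; [exact: cf|exact: cg]. Qed.

Lemma continuous01M f g : continuous01 f -> continuous01 g ->
  continuous01 (fun t => f t * g t).
Proof. by move=> cf cg t t01; apply: continuousM; [exact: cf|exact: cg]. Qed.

Lemma continuous01_cst (c : R) : continuous01 (fun=> c).
Proof. by move=> t _; exact: cst_continuous. Qed.

Lemma continuous01_sum (I : Type) (r : seq I) (F : I -> R -> R) :
  (forall i, continuous01 (F i)) -> continuous01 (fun t => \sum_(i <- r) F i t).
Proof.
move=> cF; elim: r => [|i r IH].
  by under eq_fun do rewrite big_nil; exact: continuous01_cst.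
by under eq_fun do rewrite big_cons; exact: continuous01D.
Qed.

Lemma integral01_sum (I : Type) (r : seq I) (F : I -> R -> R) :
  (forall i, continuous01 (F i)) ->
  integral01 (fun t => \sum_(i <- r) F i t) = \sum_(i <- r) integral01 (F i).
Proof.
move=> cF; elim: r => [|i r IH].
  under eq_fun do rewrite big_nil.
  by rewrite /integral01 Rintegral_cst// mul0r big_nil.
under eq_fun do rewrite big_cons.
by rewrite integral01D ?IH ?big_cons//; exact: continuous01_sum.
Qed.

Lemma integral01_bound f (M : R) : continuous01 f ->
  (forall t, 0 <= t <= 1 -> `|f t| <= M) -> `|integral01 f| <= M.
Proof.
move=> cf fM; apply: le_trans (le_normr_Rintegral _ (integrable01 cf)) _ => //.
apply: (@le_trans _ _ (integral01 (fun=> M))).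
  have iM : (@lebesgue_measure R).-integrable `[0, 1] (EFin \o fun=> M).
    by apply: integrable01; exact: continuous01_cst.
  have iF : (@lebesgue_measure R).-integrable `[0, 1] (EFin \o fun t => `|f t|).
    apply: integrable01 => t t01.
    by apply: continuous_comp; [exact: cf|exact: norm_continuous].
  apply: (le_Rintegral _ iF iM) => // t; rewrite /= in_itv/=; exact: fM.
rewrite /integral01 Rintegral_cst//= lebesgue_measure_itv/= lte_fin ltr01.
by rewrite oppr0 adde0 mulr1.
Qed.

Lemma integral01_FTC (F f : R -> R) : continuous01 f ->
  (forall t : R, 0 <= t <= 1 -> is_derive t 1 F (f t)) ->
  integral01 f = F 1 - F 0.
Proof.
move=> cf dF; rewrite /integral01 /Rintegral (@continuous_FTC2 _ f F 0 1)//.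
- apply: continuous_in_subspaceT => t; rewrite inE/= in_itv/= => t01; exact: cf.
- have cF (t : R) : 0 <= t <= 1 -> F @ t --> F t.
    move=> /dF[dFt _].
    exact/(@differentiable_continuous _ _ _ t (F : R -> R^o))/derivable1_diffP.
  split=> [t|//|//].
  + by rewrite in_itv/= => /andP[t0 t1]; have [] := dF t; rewrite ?(ltW t0) ?(ltW t1).
  + by apply: cvg_at_right_filter; apply: cF; rewrite lexx ler01.
  + by apply: cvg_at_left_filter; apply: cF; rewrite lexx ler01.
- move=> t; rewrite in_itv/= => /andP[t0 t1].
  by have [] := dF t; rewrite ?(ltW t0) ?(ltW t1)// derive1E.
Qed.

End UnitIntegral.

(** The estimate says that the zero map is a first-order approximation of [f] at [y]. *)
Lemma derive_eq0 (K : numFieldType) (V W : normedModType K) (f : V -> W) (y : V) :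
  (forall e : K, 0 < e -> \forall h \near (0 : V), `|f (h + y) - f y| <= e * `|h|) ->
  differentiable f y /\ forall v, 'D_v f y = 0.
Proof.
move=> H.
have E : f \o shift y = cst (f y) + (\0 : {linear V -> W}) +o_ 0 id.
  apply/eqaddoP => e e0; apply: filterS (H e e0) => h.
  by rewrite !fctE /= addr0.
have c0 : continuous (\0 : {linear V -> W}) by exact: cst_continuous.
have D0 := diff_unique c0 E.
have df : differentiable f y by apply/diff_locallyP; rewrite D0.
by split=> // v; rewrite deriveE// D0.
Qed.

(** * Integrals along segments and differentiation under the integral sign *)

Section Hadamard.
Context {R : realType} {n : nat}.
Implicit Types (W : set 'rV[R]_n) (phi : 'rV[R]_n -> R) (y h v : 'rV[R]_n).

Definition seg (x0 y : 'rV[R]_n) (t : R) : 'rV[R]_n := x0 + t *: (y - x0).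

Lemma seg_continuous (x0 : 'rV[R]_n) y : continuous (seg x0 y).
Proof.
move=> t; apply: cvgD; first exact: cvg_cst.
exact: scalel_continuous.
Qed.

Lemma segD (x0 : 'rV[R]_n) y h t : seg x0 (h + y) t = seg x0 y t + t *: h.
Proof. by rewrite /seg -[RHS]addrA -scalerDr -addrA (addrC h). Qed.

(** Compactness of [[0, 1]], in its near-covering form, makes the modulus of continuity uniform
    along the segment. This uniformity is what lets limits pass under the integral. *)
Lemma seg_near phi (x0 : 'rV[R]_n) y (e : R) : 0 < e ->
  (forall t, 0 <= t <= 1 -> {for seg x0 y t, continuous phi}) ->
  exists2 d : R, 0 < d & forall t h, 0 <= t <= 1 -> `|h| < d ->
    `|phi (seg x0 y t + h) - phi (seg x0 y t)| <= e.
Proof.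
move=> e0 cphi.
have : \forall h \near (0 : 'rV[R]_n), `[0, 1]%classic `<=`
    [set t | `|phi (seg x0 y t + h) - phi (seg x0 y t)| <= e].
  have /compact_near_coveringP cov := @segment_compact R 0 1.
  apply: (cov _ (nbhs (0 : 'rV[R]_n)) (fun h t =>
    `|phi (seg x0 y t + h) - phi (seg x0 y t)| <= e)) => t /=; rewrite in_itv/= => t01.
  have /cvgrPdist_lt/(_ (e / 2)) := cphi t t01.
  rewrite divr_gt0// => /(_ isT)/nbhs_ballP[d /= d0 Hd].
  have Hs : \forall t' \near t, `|seg x0 y t - seg x0 y t'| < d / 2.
    by have /cvgrPdist_lt := @seg_continuous x0 y t; apply; rewrite divr_gt0.
  have Hh : \forall h \near (0 : 'rV[R]_n), `|h| < d / 2.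
    apply/nbhs_ballP; exists (d / 2) => /=; first by rewrite divr_gt0.
    by move=> h /=; rewrite -ball_normE/= sub0r normrN.
  exists ([set t' | `|seg x0 y t - seg x0 y t'| < d / 2], [set h | `|h| < d / 2]) => //=.
  move=> [t' h] /= [s1 h1].
  have A : `|phi (seg x0 y t) - phi (seg x0 y t')| < e / 2.
    apply: Hd; rewrite -ball_normE/=; apply: lt_trans s1 _.
    by rewrite ltr_pdivrMr// ltr_pMr// ltr1n.
  have B : `|phi (seg x0 y t) - phi (seg x0 y t' + h)| < e / 2.
    apply: Hd; rewrite -ball_normE/= opprD addrA [ltRHS]splitr.
    by apply: le_lt_trans (ler_normB _ _) _; rewrite ltrD.
  rewrite -[X in `|X|](subrKA (phi (seg x0 y t))) [leRHS]splitr.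
  by apply: le_trans (ler_normD _ _) _; rewrite lerD// ltW// distrC.
move=> /nbhs_ballP[d /= d0 Hd]; exists d => // t h t01 hd.
by apply: (Hd h) => //=; rewrite -ball_normE/= sub0r normrN.
Qed.

(** The Hadamard remainder is the case [m = 0] applied to a partial derivative. The weight [t ^+ m]
    closes the family under differentiation: each derivative in [y] brings out a factor [t] from
    [seg x0 y t]. *)
Definition hadamard (x0 : 'rV[R]_n) (m : nat) phi y : R :=
  integral01 (fun t => t ^+ m * phi (seg x0 y t)).

Variables (W : set 'rV[R]_n) (x0 : 'rV[R]_n).
Hypothesis oW : open W.
Hypothesis starW : forall y t, W y -> 0 <= t <= 1 -> W (seg x0 y t).

Lemma continuous01_hadamard m phi y : W y ->
  (forall x, W x -> {for x, continuous phi}) ->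
  continuous01 (fun t => t ^+ m * phi (seg x0 y t)).
Proof.
move=> Wy cphi; apply: continuous01M => t t01; first exact: exprn_continuous.
by apply: continuous_comp; [exact: seg_continuous|apply: cphi; exact: starW].
Qed.

Lemma normZ01 (t : R) h : 0 <= t <= 1 -> `|t *: h| <= `|h|.
Proof.
by move=> /andP[t0 t1]; rewrite normrZ ger0_norm// ler_piMl.
Qed.

Lemma norm01X (t a : R) m : 0 <= t <= 1 -> `|t ^+ m * a| <= `|a|.
Proof.
move=> /andP[t0 t1].
by rewrite normrM normrX (ger0_norm t0) ler_piMl// exprn_ile1.
Qed.

Lemma continuous_hadamard m phi y : W y ->
  (forall x, W x -> {for x, continuous phi}) ->
  {for y, continuous (hadamard x0 m phi)}.
Proof.
move=> Wy cphi; apply/(@cvgrPdist_le _ _ _ (nbhs y) (nbhs_filter y)) => e e0.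
have [|d d0 Hd] := @seg_near phi x0 y e e0; first by move=> t t01; exact/cphi/starW.
have WN : \forall z \near y, W z by exact: open_nbhs_nbhs.
have DN : \forall z \near y, `|z - y| < d.
  by apply/nbhs_ballP; exists d => //= z; rewrite -ball_normE/= distrC.
near=> z.
have Wz : W z by near: z.
have zd : `|z - y| < d by near: z.
have -> : hadamard x0 m phi y - hadamard x0 m phi z = - 1 *
    integral01 (fun t => t ^+ m * phi (seg x0 z t) + -1 * (t ^+ m * phi (seg x0 y t))).
  rewrite integral01D ?integral01Z; [|exact: continuous01_hadamard..|].
    by rewrite !mulN1r opprB.
  by apply: continuous01M; [exact: continuous01_cst|exact: continuous01_hadamard].
rewrite mulN1r normrN; apply: integral01_bound.
  apply: continuous01D; first exact: continuous01_hadamard.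
  by apply: continuous01M; [exact: continuous01_cst|exact: continuous01_hadamard].
move=> t t01; rewrite mulN1r -mulrBr (le_trans (norm01X _ _ t01))//.
rewrite -{1}(subrK y z) segD; apply: Hd => //.
exact: le_lt_trans (normZ01 _ t01) _.
Unshelve. all: by end_near. Qed.

(** Differentiation under the integral: the candidate differential [ell] is subtracted, and the mean
    value theorem together with the uniform modulus of the partial derivatives shows that the rest
    is [o(h)]. *)
Lemma derive_hadamard m phi y : W y -> is_Ck 1 W phi ->
  differentiable (hadamard x0 m phi) y /\
  forall v, 'D_v (hadamard x0 m phi) y =
    \sum_k v 0 k * hadamard x0 m.+1 (fun x => 'D_(delta_mx 0 k) phi x) y.
Proof.
move=> Wy [dphi cD].
have cphi x : W x -> {for x, continuous phi} by move=> /dphi/differentiable_continuous.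
pose c k := hadamard x0 m.+1 (fun x => 'D_(delta_mx 0 k) phi x) y.
pose ell (z : 'rV[R]_n) : R := \sum_k c k * z 0 k.
have dell x : differentiable ell x.
  have -> : ell = \sum_k (fun z : 'rV[R]_n => c k * z 0 k).
    by apply/funext => z; rewrite fct_sumE.
  apply: differentiable_sum => k; apply: differentiableM; first exact: differentiable_cst.
  exact: differentiable_coord.
have lell a x z : ell (a *: x + z) = a * ell x + ell z.
  rewrite /ell mulr_sumr -big_split/=; apply: eq_bigr => k _.
  by rewrite !mxE; ring.
have ellD v x : 'D_v ell x = ell v.
  pose L : {linear 'rV[R]_n -> R^o} := HB.pack ell (GRing.isLinear.Build _ _ _ _ ell lell).
  rewrite deriveE; last exact: dell.
  have -> : ell = L :> (_ -> _) by [].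
  rewrite diff_lin// => z; exact/differentiable_continuous/dell.
suff [dg Dg] : differentiable (hadamard x0 m phi - ell) y /\
    forall v, 'D_v (hadamard x0 m phi - ell) y = 0.
  have E : hadamard x0 m phi = (hadamard x0 m phi - ell) + ell by rewrite subrK.
  split=> [|v]; first by rewrite E; exact: differentiableD.
  rewrite E deriveD; [|exact: diff_derivable..].
  by rewrite Dg add0r ellD; apply: eq_bigr => k _; rewrite mulrC.
apply: (@derive_eq0 _ _ R^o) => e e0.
(* The error is shared among the [n] partial derivatives; [n.+1] avoids a division by zero. *)
have e'0 : 0 < e / n.+1%:R by rewrite divr_gt0.
have Hk k : exists2 d : R, 0 < d & forall t h, 0 <= t <= 1 -> `|h| < d ->
    `|'D_(delta_mx 0 k) phi (seg x0 y t + h) - 'D_(delta_mx 0 k) phi (seg x0 y t)|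
      <= e / n.+1%:R.
  apply: (@seg_near (fun x => 'D_(delta_mx 0 k) phi x)) => // t t01.
  by apply: (cD (delta_mx 0 k)); exact: starW.
have [d d0 Hd] : exists2 d : R, 0 < d & forall k t h, 0 <= t <= 1 -> `|h| < d ->
    `|'D_(delta_mx 0 k) phi (seg x0 y t + h) - 'D_(delta_mx 0 k) phi (seg x0 y t)|
      <= e / n.+1%:R.
  have [f Hf] := choice (fun k => let: ex_intro2 d d0 Hd := Hk k in ex_intro _ d (conj d0 Hd)).
  (* The minimum starts at [1], hence is positive also for [n = 0]. *)
  exists (\big[Num.min/1]_k f k).
    by apply/lt_bigmin => [//|k _]; exact: (Hf k).1.
  move=> k t h t01 hd; apply: (Hf k).2 => //; apply: lt_le_trans hd _.
  exact: bigmin_le_cond.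
have /nbhs_ballP[r /= r0 Wr] : nbhs y W by exact: open_nbhs_nbhs.
apply/nbhs_ballP; exists (Num.min d r) => /=; first by rewrite lt_min d0.
move=> h /=; rewrite -ball_normE/= sub0r normrN lt_min => /andP[hd hr].
have Wh (t : R) : 0 <= t <= 1 -> W (t *: h + y).
  move=> t01; apply: Wr; rewrite -ball_normE/= opprD addrC subrK normrN.
  exact: le_lt_trans (normZ01 _ t01) hr.
have Why : W (h + y) by rewrite -[h]scale1r; apply: Wh; rewrite ler01 lexx.
rewrite !fctE.
have -> : hadamard x0 m phi (h + y) - ell (h + y) - (hadamard x0 m phi y - ell y) =
    hadamard x0 m phi (h + y) + -1 * hadamard x0 m phi y + -1 * ell h.
  have -> : ell (h + y) = ell h + ell y by rewrite -[h in LHS]scale1r lell mul1r.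
  by ring.
have cT z : W z -> continuous01 (fun t => t ^+ m * phi (seg x0 z t)).
  by move=> Wz; exact: continuous01_hadamard.
have cD' k : continuous01 (fun t => t ^+ m.+1 * 'D_(delta_mx 0 k) phi (seg x0 y t)).
  by apply: (@continuous01_hadamard _ (fun x => 'D_(delta_mx 0 k) phi x)) => // x; exact: cD.
have cS k : continuous01 (fun t => h 0 k * (t ^+ m.+1 * 'D_(delta_mx 0 k) phi (seg x0 y t))).
  by apply: continuous01M => //; exact: continuous01_cst.
have cN (f : R -> R) : continuous01 f -> continuous01 (fun t => -1 * f t).
  by move=> cf; apply: continuous01M => //; exact: continuous01_cst.
have -> : ell h = integral01 (fun t => \sum_k
    h 0 k * (t ^+ m.+1 * 'D_(delta_mx 0 k) phi (seg x0 y t))).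
  rewrite integral01_sum//; apply: eq_bigr => k _.
  by rewrite integral01Z// mulrC.
have cSS := @continuous01_sum R _ (index_enum 'I_n) _ cS.
have E1 := integral01D (cT _ Why) (cN _ (cT _ Wy)).
have E2 := integral01D (continuous01D (cT _ Why) (cN _ (cT _ Wy))) (cN _ cSS).
rewrite E1 !integral01Z// in E2; last exact: cT.
rewrite /hadamard -E2.
apply: integral01_bound.
  by apply: continuous01D; [apply: continuous01D; [exact: cT|exact/cN/cT]|exact/cN].
move=> t t01; rewrite segD.
set p := seg x0 y t; set q := t *: h.
have -> : \sum_k h 0 k * (t ^+ m.+1 * 'D_(delta_mx 0 k) phi p) = t ^+ m * 'D_q phi p.
  rewrite (derive_partial q); last exact/dphi/starW.
  rewrite mulr_sumr; apply: eq_bigr => k _; rewrite mxE exprS; ring.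
rewrite !mulN1r -!mulrBr (le_trans (norm01X _ _ t01))//.
(* The point [p + s q] is [seg x0 (s h + y) t], so star-shapedness keeps it in [W]. *)
have Wpq (s : R) : 0 <= s <= 1 -> W (p + s *: q).
  move=> s01; rewrite /q scalerA mulrC -scalerA -segD; apply: starW => //; exact: Wh.
have dpq (s : R) : 0 <= s <= 1 ->
    is_derive s 1 (fun s : R => phi (p + s *: q)) ('D_q phi (p + s *: q)).
  move=> s01; have dp := dphi _ (Wpq s s01).
  have dl : is_diff s (fun s : R => p + s *: q) (fun s => s *: q).
    apply: is_diff_eq; exact: add0r.
  have dc : differentiable (phi \o (fun s : R => p + s *: q)) s.
    by apply: differentiable_comp.
  apply: DeriveDef; first exact: diff_derivable.
  by rewrite deriveE// diff_comp//= diff_val scale1r deriveE.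
have [s /[!in_itv]/= s01 Hs] : exists2 s, s \in `[0, 1] &
    phi (p + 1 *: q) - phi (p + 0 *: q) = 'D_q phi (p + s *: q) * (1 - 0).
  apply: (@MVT_segment _ (fun s => phi (p + s *: q)) (fun s => 'D_q phi (p + s *: q))) => //.
    by move=> s; rewrite in_itv/= => /andP[s0 s1]; apply: dpq; rewrite !ltW.
  apply: continuous_in_subspaceT => s; rewrite inE/= in_itv/= => s01.
  have [ds _] := dpq s s01.
  by apply/differentiable_continuous/derivable1_diffP.
move: Hs; rewrite scale1r scale0r addr0 subr0 mulr1 => ->.
rewrite (derive_partial q (dphi _ (Wpq s s01))).
rewrite (derive_partial q (dphi _ (starW Wy t01))) -sumrB.
apply: le_trans (ler_norm_sum _ _ _) _.
have le1 k : `|q 0 k * 'D_(delta_mx 0 k) phi (p + s *: q) - q 0 k * 'D_(delta_mx 0 k) phi p|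
    <= `|h| * (e / n.+1%:R).
  rewrite -mulrBr normrM ler_pM//.
    by apply: le_trans (normZ01 h t01); exact: ler_coord_norm.
  apply: Hd => //; apply: le_lt_trans hd.
  by rewrite /q (le_trans (normZ01 _ s01))// normZ01.
apply: le_trans (ler_sum _ (fun k _ => le1 k)) _.
rewrite sumr_const card_ord -[leLHS]mulr_natl mulrCA [leRHS]mulrC ler_wpM2l//.
rewrite mulrA ler_pdivrMr// mulrC ler_wpM2l ?ler_nat// ltW//.
Qed.

Lemma is_Ck_hadamard k m phi : is_Ck k W phi -> is_Ck k W (hadamard x0 m phi).
Proof.
elim: k m phi => [|k IH] m phi Cphi.
  by move=> y Wy; exact: continuous_hadamard.
have C1 : is_Ck 1 W phi by apply: is_Ck_le Cphi.
split=> [y Wy|v]; first by have [] := derive_hadamard m Wy C1.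
apply: (@is_Ck_eq _ _ k W (fun y =>
    \sum_k v 0 k * hadamard x0 m.+1 (fun x => 'D_(delta_mx 0 k) phi x) y)) => //.
  by move=> y Wy; have [_ ->] := derive_hadamard m Wy C1.
apply: is_Ck_sum => // i _; apply: is_CkM => //; first exact: is_Ck_cst.
by apply: IH; exact: Cphi.2.
Qed.

(** This is the fundamental theorem of calculus for [phi] along the segment from [x0] to [y]. *)
Lemma hadamard_expansion phi y : W y -> is_Ck 1 W phi ->
  phi y - phi x0 = \sum_k (y - x0) 0 k *
    hadamard x0 0 (fun x => 'D_(delta_mx 0 k) phi x) y.
Proof.
move=> Wy [dphi cD].
pose f k t := (y - x0) 0 k * (t ^+ 0 * 'D_(delta_mx 0 k) phi (seg x0 y t)).
have cf k : continuous01 (f k).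
  apply: continuous01M; first exact: continuous01_cst.
  by apply: (@continuous01_hadamard _ (fun x => 'D_(delta_mx 0 k) phi x)) => // x; exact: cD.
have -> : \sum_k (y - x0) 0 k * hadamard x0 0 (fun x => 'D_(delta_mx 0 k) phi x) y =
    integral01 (fun t => \sum_k f k t).
  rewrite integral01_sum//; apply: eq_bigr => k _; rewrite integral01Z//.
  by apply: (@continuous01_hadamard _ (fun x => 'D_(delta_mx 0 k) phi x)) => // x; exact: cD.
have dF (t : R) : 0 <= t <= 1 -> is_derive t 1 (phi \o seg x0 y) (\sum_k f k t).
  move=> t01; have dp := dphi _ (starW Wy t01).
  have dl : is_diff t (seg x0 y) (fun s => s *: (y - x0)).
    apply: is_diff_eq; exact: add0r.
  have dc : differentiable (phi \o seg x0 y) t by exact: differentiable_comp.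
  apply: DeriveDef; first exact: diff_derivable.
  rewrite deriveE// diff_comp//= diff_val scale1r -deriveE// (derive_partial _ dp).
  by apply: eq_bigr => k _; rewrite /f expr0 mul1r.
rewrite (integral01_FTC (@continuous01_sum R _ (index_enum _) _ cf) dF).
by rewrite /= /seg scale1r scale0r addr0 (addrC x0) subrK.
Qed.

Lemma hadamard_center phi : hadamard x0 0 phi x0 = phi x0.
Proof.
rewrite /hadamard /seg subrr; under eq_fun do rewrite scaler0 addr0 expr0 mul1r.
rewrite /integral01 Rintegral_cst//= lebesgue_measure_itv/= lte_fin ltr01.
by rewrite oppr0 adde0 mulr1.
Qed.

End Hadamard.

(** * Extension by zero and locality of tangent vectors *)

Section ClosedBox.
Context {R : realType} {n : nat}.
Implicit Types (c y : 'rV[R]_n) (r : R).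

Definition cbox c r : set 'rV[R]_n := [set y | `|y - c| <= r].

Lemma cbox_closed c r : closed (cbox c r).
Proof.
rewrite -openC openE => y /= /negP; rewrite -ltNge => yr; apply/nbhs_ballP.
exists (`|y - c| - r) => /=; first by rewrite subr_gt0.
move=> z; rewrite -ball_normE/= ltrBrDr -ltrBrDl => H /=.
apply/negP; rewrite -ltNge; apply: (lt_le_trans H).
by rewrite lerBlDr -(subrKA z y (- c)) [leRHS]addrC ler_normD.
Qed.

Lemma cbox_compact c r : compact (cbox c r).
Proof.
apply: bounded_closed_compact; last exact: cbox_closed.
exists (r + `|c|); split; first exact: num_real.
move=> M rM y yr; apply: ltW; apply: le_lt_trans rM.
by rewrite -[y](subrK c) (le_trans (ler_normD _ _))// lerD2r.
Qed.

Lemma ball_open_subset (U : set 'rV[R]_n) c : open U -> U c ->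
  exists2 r, 0 < r & cbox c (r *+ 2) `<=` U.
Proof.
move=> oU Uc; have /nbhs_ballP[d /= d0 dU] : nbhs c U by exact: open_nbhs_nbhs.
exists (d / 3); first by rewrite divr_gt0.
move=> y /= yd; apply: dU; rewrite -ball_normE/= distrC; apply: le_lt_trans yd _.
by rewrite -mulr_natr; lra.
Qed.

Lemma near_box c r : 0 < r -> \forall y \near c, `|y - c| < r.
Proof.
move=> r0; apply/nbhs_ballP; exists r => //= y.
by rewrite -ball_normE/= distrC.
Qed.

Lemma open_box c r : open [set y | `|y - c| < r].
Proof.
rewrite openE => y /= yr; apply/nbhs_ballP; exists (r - `|y - c|) => /=.
  by rewrite subr_gt0.
move=> z; rewrite -ball_normE/= ltrBrDr => H.
rewrite -(subrKA y) (le_lt_trans (ler_normD _ _))// distrC//.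
Qed.

Lemma box_bump0_notin c r y : 0 < r -> ~ cbox c (r *+ 2) y -> box_bump c r y = 0.
Proof.
move=> r0 /negP; rewrite -ltNge => yc.
by apply: box_bump0 => //; exact: ltW.
Qed.

(** Each point lies in [W], where both factors are smooth, or in the open complement of the closed
    box, where the product vanishes whatever [g] is. *)
Lemma is_Coo_box_bumpM (W U : set 'rV[R]_n) c r (g : 'rV[R]_n -> R) : 0 < r ->
  open W -> cbox c (r *+ 2) `<=` W -> is_Coo W g ->
  is_Coo U (fun y => box_bump c r y * g y).
Proof.
move=> r0 oW cW Cg k; apply: is_CkP => y _.
have [Wy|nWy] := pselect (W y).
  apply: (@is_Ck_sub _ _ k W); first by move=> _ ->.
  by apply: is_CkM => //; exact: is_Coo_box_bump.
have : \forall z \near y, 0 = box_bump c r z * g z.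
  have : open_nbhs y (~` cbox c (r *+ 2)).
    by split; [exact/closed_openC/cbox_closed|move=> /cW].
  move=> /open_nbhs_nbhs; apply: filterS => z Hz.
  by rewrite box_bump0_notin// mul0r.
move=> /is_Ck_near; apply; apply: (@is_Ck_sub _ _ k setT) => //.
exact: is_Ck_cst openT.
Qed.

End ClosedBox.

Section SmoothLocal.
Context {R : realType} {n : nat} {M : manifold R n}.
Implicit Types (p q : M) (i j : matlas M).

Lemma near_param i (y : 'rV[R]_n) (P : M -> Prop) : (mcoord i @` mdom i) y ->
  (\forall q \near mparam i y, P q) -> \forall z \near y, P (mparam i z).
Proof. by move=> iy; exact: (mparam_continuous iy). Qed.

Lemma near_coord i p (P : 'rV[R]_n -> Prop) : mdom i p ->
  (\forall y \near mcoord i p, P y) -> \forall q \near p, P (mcoord i q).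
Proof. by move=> ip; exact: (mcoord_continuous ip). Qed.

Lemma near_mdom i p : mdom i p -> \forall q \near p, mdom i q.
Proof. by move=> ip; apply: open_nbhs_nbhs; split => //; exact: mdom_open. Qed.

Lemma coordK i y : (mcoord i @` mdom i) y -> mcoord i (mparam i y) = y.
Proof. by move=> [p ip <-]; rewrite mcoordK. Qed.

Lemma mdom_param i y : (mcoord i @` mdom i) y -> mdom i (mparam i y).
Proof. by move=> [p ip <-]; rewrite mcoordK. Qed.

Lemma near_image i p : mdom i p ->
  \forall y \near mcoord i p, (mcoord i @` mdom i) y.
Proof.
by move=> ip; apply: open_nbhs_nbhs; split; [exact: mimage_open|exists p].
Qed.

Lemma is_smooth_local (f : M -> R) :
  (forall p, exists2 g : M -> R, is_smooth g & \forall q \near p, f q = g q) ->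
  is_smooth f.
Proof.
move=> H i k; apply: is_CkP => y iy.
have [g Cg fg] := H (mparam i y).
apply: (@is_Ck_near _ _ k y (g \o mparam i)).
  by apply: (near_param (P := fun q => g q = f q)) => //; apply: filterS fg => q.
by apply: is_Ck_sub (Cg i k) => _ ->.
Qed.

Definition chart_ext i (f : 'rV[R]_n -> R) p : R :=
  if p \in mdom i then f (mcoord i p) else 0.

Lemma chart_extE i f p : mdom i p -> chart_ext i f p = f (mcoord i p).
Proof. by move=> ip; rewrite /chart_ext mem_set. Qed.

Lemma open_preimage_param i (O : set M) : open O ->
  open ((mcoord i @` mdom i) `&` mparam i @^-1` O).
Proof.
move=> oO; rewrite openE => y [iy Oy]; apply: filterI.
  by apply: open_nbhs_nbhs; split => //; exact: mimage_open.
by apply: (near_param (P := O)) => //; exact: open_nbhs_nbhs.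
Qed.

(** Inside the domain of [i] a transition map reduces to [f]. At any other point, the image of [K]
    in [M] is compact, hence closed by the Hausdorff property, so the extension vanishes nearby. *)
Lemma is_smooth_chart_ext i (f : 'rV[R]_n -> R) (K : set 'rV[R]_n) :
  compact K -> K `<=` mcoord i @` mdom i -> is_Coo (mcoord i @` mdom i) f ->
  (forall y, ~ K y -> f y = 0) -> is_smooth (chart_ext i f).
Proof.
move=> cK Ki Cf f0 j k; apply: is_CkP => y jy.
have [iy|niy] := pselect (mdom i (mparam j y)).
  pose U := (mcoord j @` mdom j) `&` mparam j @^-1` mdom i.
  have oU : open U by exact/open_preimage_param/mdom_open.
  apply: (@is_Ck_sub _ _ k U); first by move=> _ ->.
  apply: (@is_Ck_eq _ _ k U (f \o (mcoord i \o mparam j))) => //.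
    by move=> z [_ iz]; rewrite /= chart_extE.
  apply: (@is_Ck_comp _ _ _ _ U (mcoord i @` mdom i)) => //.
    by move=> z [_ iz]; exists (mparam j z).
  move=> l; apply: is_Ck_sub (mtransition j i l k).
  by move=> z [jz iz]; exists (mparam j z); [split => //; exact: mdom_param|exact: coordK].
have cPK : closed (mparam i @` K).
  apply: compact_closed; first exact: mhausdorff.
  apply: continuous_compact => //; apply: continuous_in_subspaceT => z; rewrite inE => /Ki.
  exact: mparam_continuous.
have : \forall z \near y, 0 = chart_ext i f (mparam j z).
  apply: (near_param (P := fun q => 0 = chart_ext i f q)) => //.
  have : open_nbhs (mparam j y) (~` (mparam i @` K)).
    split; first exact/closed_openC.
    by move=> [z Kz zy]; apply: niy; rewrite -zy; exact/mdom_param/Ki.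
  move=> /open_nbhs_nbhs; apply: filterS => q qK; rewrite /chart_ext.
  case: ifPn => //; rewrite inE => iq; rewrite f0// => Kq.
  by apply: qK; exists (mcoord i q) => //; exact: mcoordK.
move=> /is_Ck_near; apply; apply: (@is_Ck_sub _ _ k setT) => //.
exact: is_Ck_cst openT.
Qed.

Lemma exists_bump p (O : set M) : nbhs p O ->
  exists rho : smoothfun M, (\forall q \near p, rho q = 1) /\
    forall q, ~ O q -> rho q = 0.
Proof.
move=> Op; have [i ip] := mcover p.
pose U := (mcoord i @` mdom i) `&` mparam i @^-1` (O^°).
have oU : open U by apply: open_preimage_param; exact: open_interior.
have Up : U (mcoord i p) by split; [exists p|rewrite /= mcoordK].
have [r r0 rU] := ball_open_subset oU Up.
have Crho : is_smooth (chart_ext i (box_bump (mcoord i p) r)).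
  apply: (@is_smooth_chart_ext i _ (cbox (mcoord i p) (r *+ 2))) => [|||y].
  - exact: cbox_compact.
  - by move=> y /rU[].
  - by apply: is_Coo_box_bump; exact: mimage_open.
  - exact: box_bump0_notin.
exists (Smoothfun Crho); split => [|q nOq] /=.
  have : \forall q \near p, mdom i q /\ `|mcoord i q - mcoord i p| < r.
    apply: filterI; first exact: near_mdom.
    exact: (near_coord ip (near_box _ r0)).
  by apply: filterS => q [iq qr]; rewrite chart_extE// box_bump1// ltW.
rewrite /chart_ext; case: ifPn => //; rewrite inE => iq.
apply: box_bump0_notin => // /rU[_]; rewrite /= mcoordK// => Oq.
exact: nOq (interior_subset Oq).
Qed.

Lemma tangent0 p (u : tangent p) : u 0 = 0.
Proof.
have /eqP := Defs.tanD u 0 0.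
by rewrite addr0 -subr_eq0 opprD addNKr oppr_eq0 => /eqP.
Qed.

Lemma tangentB p (u : tangent p) f g : u (f - g) = u f - u g.
Proof.
have uN h : u (- h) = - u h.
  by apply/eqP; rewrite -addr_eq0 -Defs.tanD addNr tangent0.
by rewrite Defs.tanD uN.
Qed.

Lemma tangentZ p (u : tangent p) (c : R) f : u (c *: f) = c * u f.
Proof. by rewrite -[c *: f]addr0 tan_linear tangent0 addr0. Qed.

Lemma tangent_sum p (u : tangent p) (I : Type) (r : seq I) (P : pred I) F :
  u (\sum_(i <- r | P i) F i) = \sum_(i <- r | P i) u (F i).
Proof. by apply: (big_morph u); [move=> f g; exact: Defs.tanD|exact: tangent0]. Qed.

Lemma tangent1 p (u : tangent p) : u 1 = 0.
Proof.
have := tan_leibniz u 1 1; rewrite mulr1 mul1r => /eqP.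
by rewrite -subr_eq0 opprD addNKr oppr_eq0 => /eqP.
Qed.

Lemma tangent_cst p (u : tangent p) c : u (sfun_cst c) = 0.
Proof.
have -> : sfun_cst c = c *: (1 : smoothfun M) by apply: sfunP => q; rewrite sfunZE mulr1.
by rewrite tangentZ tangent1 mulr0.
Qed.

(** With a bump [rho] supported where [f = g], one has [f - g = (f - g) * (1 - rho)]. Both factors
    vanish at [p], so the Leibniz rule gives [0]. *)
Lemma tangent_local p (u : tangent p) (f g : smoothfun M) :
  (\forall q \near p, f q = g q) -> u f = u g.
Proof.
move=> fg; apply/eqP; rewrite -subr_eq0 -tangentB; apply/eqP.
have [rho [rho1 rho0]] := exists_bump fg.
have -> : f - g = (f - g) * (1 - rho).
  apply: sfunP => q; rewrite sfunME sfunDE sfunNE sfunDE sfunNE.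
  have [->|/rho0 ->] := pselect (f q = g q); first by rewrite subrr mul0r.
  by rewrite subr0 mulr1.
rewrite tan_leibniz !sfunDE !sfunNE (nbhs_singleton fg) (nbhs_singleton rho1).
by rewrite !subrr !mul0r addr0.
Qed.

End SmoothLocal.

(** * Local frames *)

Section LocalFrame.
Context {R : realType} {n : nat} {M : manifold R n}.
Variables (i : matlas M) (c : 'rV[R]_n) (r : R).
Hypotheses (r_gt0 : 0 < r) (cbox_image : cbox c (r *+ 2) `<=` mcoord i @` mdom i).

Let e (k : 'I_n) : 'rV[R]_n := delta_mx 0 k.

Lemma is_smooth_box_bumpM (W : set 'rV[R]_n) (f : 'rV[R]_n -> R) :
  open W -> cbox c (r *+ 2) `<=` W -> is_Coo W f ->
  is_smooth (chart_ext i (fun y => box_bump c r y * f y)).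
Proof.
move=> oW cW Cf; apply: (@is_smooth_chart_ext _ _ _ i _ (cbox c (r *+ 2))) => [||| y cy].
- exact: cbox_compact.
- exact: cbox_image.
- exact: is_Coo_box_bumpM Cf.
- by rewrite box_bump0_notin// mul0r.
Qed.

Lemma param_differentiable (f : smoothfun M) y : (mcoord i @` mdom i) y ->
  differentiable (f \o mparam i) y.
Proof. by move=> iy; apply: (sfun_smooth f i 1).1. Qed.

Lemma is_Coo_partial (f : smoothfun M) (k : 'I_n) :
  is_Coo (mcoord i @` mdom i) (fun y => 'D_(e k) (f \o mparam i) y).
Proof. by move=> l; apply: (sfun_smooth f i l.+1).2. Qed.

Definition chart_partial_at (k : 'I_n) (p : M) : tangent p.
Proof.
exists (fun f => chart_ext i (fun y => box_bump c r y * 'D_(e k) (f \o mparam i) y) p).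
  move=> a f g; rewrite /chart_ext; case: ifPn => [|_]; last by rewrite mulr0 addr0.
  rewrite inE => ip; have iy : (mcoord i @` mdom i) (mcoord i p) by exists p.
  have -> : (a *: f + g) \o mparam i = a *: (f \o mparam i) + (g \o mparam i) by [].
  have df : derivable (f \o mparam i) (mcoord i p) (e k).
    exact: (diff_derivable (param_differentiable f iy)).
  have dg : derivable (g \o mparam i) (mcoord i p) (e k).
    exact: (diff_derivable (param_differentiable g iy)).
  rewrite (deriveD (derivableZ (k := a) df) dg) (deriveZ _ df).
  by rewrite /GRing.scale/=; ring.
move=> f g; rewrite /chart_ext; case: ifPn => [|_]; last by rewrite !mulr0 addr0.
rewrite inE => ip; have iy : (mcoord i @` mdom i) (mcoord i p) by exists p.
have -> : (f * g) \o mparam i = (f \o mparam i) * (g \o mparam i) by [].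
have df : derivable (f \o mparam i) (mcoord i p) (e k).
    exact: (diff_derivable (param_differentiable f iy)).
have dg : derivable (g \o mparam i) (mcoord i p) (e k).
    exact: (diff_derivable (param_differentiable g iy)).
rewrite (deriveM df dg).
by rewrite /GRing.scale/= mcoordK//; ring.
Defined.

Definition chart_partial (k : 'I_n) : vfield M.
Proof.
exists (chart_partial_at k) => f.
exact: is_smooth_box_bumpM (@mimage_open _ _ _ i) cbox_image (is_Coo_partial f k).
Defined.

Definition chart_coordinate (k : 'I_n) : smoothfun M :=
  Smoothfun (is_smooth_box_bumpM openT (@subsetT _ _)
    (fun l => is_Ck_coord l k openT)).

Lemma chart_partialE k p f : mdom i p -> `|mcoord i p - c| < r ->
  chart_partial k p f = 'D_(e k) (f \o mparam i) (mcoord i p).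
Proof. by move=> ip /ltW pr; rewrite /= chart_extE// box_bump1// mul1r. Qed.

Lemma chart_coordinateE k p : mdom i p -> `|mcoord i p - c| < r ->
  chart_coordinate k p = mcoord i p 0 k.
Proof. by move=> ip /ltW pr; rewrite /= chart_extE// box_bump1// mul1r. Qed.

Lemma near_coordinate p : mdom i p -> `|mcoord i p - c| < r ->
  \forall q \near p, mdom i q /\ `|mcoord i q - c| < r.
Proof.
move=> ip pr; apply: filterI; first exact: near_mdom.
apply: (near_coord (P := fun y => `|y - c| < r) ip).
by apply: open_nbhs_nbhs; split => //; exact: open_box.
Qed.

Lemma chart_partial_coordinate k l p : mdom i p -> `|mcoord i p - c| < r ->
  chart_partial k p (chart_coordinate l) = (k == l)%:R.
Proof.
move=> ip pr; rewrite chart_partialE//.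
have iy : (mcoord i @` mdom i) (mcoord i p) by exists p.
have /near_eq_derive -> : \forall y \near mcoord i p,
    (chart_coordinate l \o mparam i) y = (y : 'rV[R]_n) 0 l.
  have : \forall y \near mcoord i p, (mcoord i @` mdom i) y /\ `|y - c| < r.
    apply: filterI; first exact: near_image.
    by apply: open_nbhs_nbhs; split => //; exact: open_box.
  apply: filterS => y [iz zr] /=.
  have iz' := mdom_param iz; rewrite chart_extE// coordK// box_bump1 ?mul1r//.
  exact: ltW.
rewrite -(@derive_row _ _ _ id)// derive_id mxE eqxx/=.
by rewrite eq_sym.
Qed.

(** Near [p], [f] is [f p] plus the sum of [(x k - x k p) * G k], where [G k] is a remainder whose
    value at [p] is the [k]-th partial derivative. A derivation at [p] sees only [v (x k)] and
    [G k p]. *)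
Lemma chart_decomposition p (v : tangent p) : mdom i p -> `|mcoord i p - c| < r ->
  v = \sum_k v (chart_coordinate k) *: chart_partial k p.
Proof.
move=> ip pr; apply: tanP => f.
set y := mcoord i p; set phi := f \o mparam i.
have iy : (mcoord i @` mdom i) y by exists p.
pose W := [set z : 'rV[R]_n | `|z - c| < r].
have oW : open W by exact: open_box.
have Wy : W y by [].
have Wi : W `<=` mcoord i @` mdom i.
  move=> z /ltW zr; apply: cbox_image; apply: le_trans zr _.
  by rewrite mulr2n lerDl ltW.
(* The box is convex, hence star-shaped about [y], which need not be its centre [c]. *)
have starW z (t : R) : W z -> 0 <= t <= 1 -> W (seg y z t).
  move=> Wz /andP[t0 t1]; rewrite /W/=.
  have -> : seg y z t - c = (1 - t) *: (y - c) + t *: (z - c).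
    rewrite /seg !scalerBr !scalerBl !scale1r.
    by apply/rowP => k; rewrite !mxE; ring.
  apply: le_lt_trans (ler_normD _ _) _; rewrite !normrZ ger0_norm ?subr_ge0//.
  rewrite (ger0_norm t0).
  have [->|t_neq0] := eqVneq t 0; first by rewrite mul0r addr0 subr0 mul1r.
  have {t_neq0}t_gt0 : 0 < t by rewrite lt_def t_neq0.
  have -> : r = (1 - t) * r + t * r by ring.
  by apply: ler_ltD; [rewrite ler_wpM2l ?subr_ge0// ltW|rewrite ltr_pM2l].
have Cphi l : is_Ck l W phi by apply: is_Ck_sub (sfun_smooth f i l).
pose g k := hadamard y 0 (fun x => 'D_(e k) phi x).
have Cg k : is_Coo W (g k).
  by move=> l; apply: is_Ck_hadamard => //; exact: (Cphi l.+1).2.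
(* The remainders are smooth on [W] only; a smaller bump around [y] makes them global functions
   without changing them near [p]. *)
have [s s0 sW] := ball_open_subset oW Wy.
have sI : cbox y (s *+ 2) `<=` mcoord i @` mdom i by move=> z /sW/Wi.
have CG k : is_smooth (chart_ext i (fun z => box_bump y s z * g k z)).
  apply: (@is_smooth_chart_ext _ _ _ i _ (cbox y (s *+ 2))) => [||| z cz].
  - exact: cbox_compact.
  - exact: sI.
  - exact: (@is_Coo_box_bumpM _ _ W _ y s (g k)).
  - by rewrite box_bump0_notin// mul0r.
pose G k : smoothfun M := Smoothfun (CG k).
pose x k := chart_coordinate k.
have -> : v f = v (sfun_cst (f p) + \sum_k (x k - sfun_cst (x k p)) * G k).
  apply: tangent_local.
  have near_s : \forall q \near p, `|mcoord i q - y| < s.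
    exact: (near_coord (P := fun z => `|z - y| < s) ip (near_box y s0)).
  apply: filterS2 near_s (near_coordinate ip pr) => q qs [iq qr].
  have Wq : W (mcoord i q) by [].
  have E := hadamard_expansion starW Wq (Cphi 1%N).
  rewrite sfunDE -[LHS](subrK (f p)) addrC; congr (_ + _).
  have -> : f q - f p = phi (mcoord i q) - phi y by rewrite /phi/y/= !mcoordK.
  have evalS (F : 'I_n -> smoothfun M) : (\sum_k F k) q = \sum_k F k q.
    by apply: (big_morph (fun h : smoothfun M => h q)).
  rewrite E evalS; apply: eq_bigr => k _; rewrite sfunME sfunDE sfunNE.
  rewrite !chart_coordinateE// [G k q]chart_extE// box_bump1 ?mul1r ?(ltW qs)//.
  by rewrite !mxE.
rewrite Defs.tanD tangent_cst add0r tangent_sum.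
have -> : (\sum_k v (x k) *: chart_partial k p) f = \sum_k v (x k) * chart_partial k p f.
  by apply: (big_morph (fun u : tangent p => u f)).
apply: eq_bigr => k _; rewrite tan_leibniz sfunDE sfunNE subrr mul0r add0r.
rewrite tangentB tangent_cst subr0 mulrC; congr (_ * _).
rewrite [LHS]chart_extE// box_bump1 ?subrr ?normr0 ?(ltW s0)// mul1r.
by rewrite /g hadamard_center chart_partialE.
Qed.

End LocalFrame.

Section Frames.
Context {R : realType} {n : nat} {M : manifold R n}.

Lemma local_frame (p : M) : exists (x : 'I_n -> smoothfun M) (E : 'I_n -> vfield M),
  \forall q \near p, (forall k l, E k q (x l) = (k == l)%:R) /\
    forall v : tangent q, v = \sum_k v (x k) *: E k q.
Proof.
have [i ip] := mcover p.
have iy : (mcoord i @` mdom i) (mcoord i p) by exists p.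
have [r r0 rU] := ball_open_subset (@mimage_open _ _ _ i) iy.
exists (chart_coordinate r0 rU), (chart_partial r0 rU).
have := near_coordinate (c := mcoord i p) (r := r) ip.
rewrite subrr normr0 => /(_ r0); apply: filterS => q [iq qr]; split=> [k l|v].
  exact: chart_partial_coordinate.
exact: chart_decomposition.
Qed.

Lemma extend_tangent (p : M) (v : tangent p) : exists X : vfield M, X p = v.
Proof.
have [x [E /nbhs_singleton[_ H]]] := local_frame p.
exists (\sum_k sfun_cst (v (x k)) *: E k).
rewrite [RHS]H; apply: (big_morph (fun X : vfield M => X p)) => //.
Qed.

End Frames.

(** * Smooth sections *)

Section TensorSums.
Context {R : realType} {n : nat} {M : manifold R n}.
Implicit Types (p : M) (T : tensor2 M) (eta : form1 M).

Lemma form1D eta p u v : eta p (u + v) = eta p u + eta p v.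
Proof. by have := f1_linear eta 1 u v; rewrite scale1r mul1r. Qed.

Lemma form10 eta p : eta p 0 = 0.
Proof. by apply: (addrI (eta p 0)); rewrite -form1D !addr0. Qed.

Lemma form1Z eta p a u : eta p (a *: u) = a * eta p u.
Proof. by rewrite -[a *: u]addr0 f1_linear form10 addr0. Qed.

Lemma form1B eta p u v : eta p (u - v) = eta p u - eta p v.
Proof. by rewrite form1D -scaleN1r form1Z mulN1r. Qed.

Lemma form1_sum eta p (I : Type) (r : seq I) (P : pred I) (F : I -> tangent p) :
  eta p (\sum_(i <- r | P i) F i) = \sum_(i <- r | P i) eta p (F i).
Proof. by apply: big_morph; [exact: form1D|exact: form10]. Qed.

Lemma tensor2Dl T p u v w : T p (u + v) w = T p u w + T p v w.
Proof. by have := t2_linearl T 1 u v w; rewrite scale1r mul1r. Qed.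

Lemma tensor2Dr T p u v w : T p w (u + v) = T p w u + T p w v.
Proof. by have := t2_linearr T 1 w u v; rewrite scale1r mul1r. Qed.

Lemma tensor20l T p u : T p 0 u = 0.
Proof. by apply: (addrI (T p 0 u)); rewrite -tensor2Dl !addr0. Qed.

Lemma tensor20r T p u : T p u 0 = 0.
Proof. by apply: (addrI (T p u 0)); rewrite -tensor2Dr !addr0. Qed.

Lemma tensor2Zl T p a u v : T p (a *: u) v = a * T p u v.
Proof. by rewrite -[a *: u]addr0 t2_linearl tensor20l addr0. Qed.

Lemma tensor2Zr T p a u v : T p u (a *: v) = a * T p u v.
Proof. by rewrite -[a *: v]addr0 t2_linearr tensor20r addr0. Qed.

Lemma tensor2Nl T p u v : T p (- u) v = - T p u v.
Proof. by rewrite -scaleN1r tensor2Zl mulN1r. Qed.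

Lemma tensor2Nr T p u v : T p u (- v) = - T p u v.
Proof. by rewrite -scaleN1r tensor2Zr mulN1r. Qed.

Lemma tensor2Bl T p u v w : T p (u - v) w = T p u w - T p v w.
Proof. by rewrite tensor2Dl tensor2Nl. Qed.

Lemma tensor2Br T p u v w : T p w (u - v) = T p w u - T p w v.
Proof. by rewrite tensor2Dr tensor2Nr. Qed.

Lemma tensor2_suml T p (I : Type) (r : seq I) (P : pred I) (F : I -> tangent p) w :
  T p (\sum_(i <- r | P i) F i) w = \sum_(i <- r | P i) T p (F i) w.
Proof.
by apply: (big_morph (fun u => T p u w)); [move=> u v; exact: tensor2Dl|exact: tensor20l].
Qed.

Lemma tensor2_sumr T p (I : Type) (r : seq I) (P : pred I) (F : I -> tangent p) w :
  T p w (\sum_(i <- r | P i) F i) = \sum_(i <- r | P i) T p w (F i).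
Proof. by apply: big_morph; [move=> u v; exact: tensor2Dr|exact: tensor20r]. Qed.

End TensorSums.

(** * Pointwise inverses and smoothness of sections *)

Section Evaluation.
Context {R : realType} {n : nat} {M : manifold R n}.
Implicit Types (p : M) (f g : smoothfun M).

(** As a ring morphism, evaluation commutes with determinants and adjugates of matrices of
    functions. *)
Definition sfun_eval p f : R := f p.

HB.instance Definition _ p := GRing.isZmodMorphism.Build (smoothfun M) R
  (sfun_eval p) (fun f g => erefl).
HB.instance Definition _ p := GRing.isMonoidMorphism.Build (smoothfun M) R
  (sfun_eval p) (conj erefl (fun f g => erefl)).

Lemma sfun_sumE (I : Type) (r : seq I) (P : pred I) (F : I -> smoothfun M) p :
  (\sum_(i <- r | P i) F i) p = \sum_(i <- r | P i) F i p.
Proof. by apply: (big_morph (fun f : smoothfun M => f p)). Qed.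

Lemma tan_sumE p (I : Type) (r : seq I) (P : pred I) (F : I -> tangent p) f :
  (\sum_(i <- r | P i) F i) f = \sum_(i <- r | P i) F i f.
Proof. by apply: (big_morph (fun u : tangent p => u f)). Qed.

Lemma is_smoothV (f : M -> R) : (forall p, f p != 0) ->
  is_smooth f -> is_smooth (fun p => (f p)^-1).
Proof.
move=> f0 Cf i k; apply: (@is_CkV _ _ k _ (f \o mparam i)); last exact: Cf.
  exact: mimage_open.
by move=> y _; exact: f0.
Qed.

Definition sfun_inv f (f0 : forall p, f p != 0) : smoothfun M :=
  Smoothfun (is_smoothV f0 (sfun_smooth f)).

Lemma sfun_near_neq0 f p : f p != 0 -> \forall q \near p, f q != 0.
Proof.
move=> fp; have [i ip] := mcover p.
have cf : {for mcoord i p, continuous (f \o mparam i)}.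
  by apply: (sfun_smooth f i 0); exists p.
have fN : nbhs ((f \o mparam i) (mcoord i p)) [set t | t != 0].
  by apply: open_nbhs_nbhs; split; [exact: open_neq|rewrite /= mcoordK].
have H : \forall y \near mcoord i p, (f \o mparam i) y != 0 := cf _ fN.
apply: filterS2 (near_coord ip H) (near_mdom ip) => q + iq.
by rewrite /= mcoordK.
Qed.

Lemma sfun_inv_near f p : f p != 0 ->
  exists g : smoothfun M, \forall q \near p, g q = (f q)^-1.
Proof.
move=> fp; have Up := sfun_near_neq0 fp.
have [rho [rho1 rho0]] := exists_bump Up.
(* [h] is a sum of squares without common zero and equals [f * f] near [p], so [f / h] is a global
   function that inverts [f] near [p]. *)
pose h := f * f + (1 - rho) * (1 - rho).
have hE q : h q = f q ^+ 2 + (1 - rho q) ^+ 2 by rewrite !expr2.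
have h0 q : h q != 0.
  rewrite hE.
  have [fq|/rho0 ->] := pselect (f q != 0).
    by rewrite gt_eqF// ltr_wpDr ?sqr_ge0// exprn_even_gt0.
  by rewrite gt_eqF// ltr_wpDl ?sqr_ge0// subr0 exprn_even_gt0 ?oner_neq0.
exists (f * sfun_inv h0); apply: filterS2 rho1 Up => q {}rho1 fq.
rewrite sfunME -[sfun_inv h0 q]/((h q)^-1) hE rho1 subrr expr0n addr0.
by rewrite expr2 invfM mulrA divff// mul1r.
Qed.

(* The coefficients of [V] in a local frame solve a linear system whose matrix,
   the Gram matrix of the forms, is invertible: Cramer's rule. *)
Lemma smooth_section (V : forall p : M, tangent p) :
  (forall p, exists (I : finType) (theta : I -> form1 M),
    (forall i, is_smooth (fun q => theta i q (V q))) /\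
    forall v : tangent p, (forall i, theta i p v = 0) -> v = 0) ->
  forall f, is_smooth (fun q => V q f).
Proof.
move=> H f; apply: is_smooth_local => p.
have [I [theta [Ctheta theta_inj]]] := H p.
have [x [E frame]] := local_frame p.
pose s i : smoothfun M := Smoothfun (Ctheta i).
pose A : 'M[smoothfun M]_n := \matrix_(k, l)
  \sum_i f1_app (theta i) (E k) * f1_app (theta i) (E l).
pose B : 'cV[smoothfun M]_n := \col_k \sum_i f1_app (theta i) (E k) * s i.
pose w := \adj A *m B.
(* A kernel vector of the Gram matrix gives a tangent vector on which the squares of all forms sum
   to zero; it is then killed by every form, hence zero. *)
have detA : (\det A) p != 0.
  apply/negP; rewrite -[(\det A) p]/(sfun_eval p _) -det_map_mx => /det0P[v v0 vA].
  have [framep decp] := nbhs_singleton frame.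
  pose a i := \sum_k v 0 k * theta i p (E k p).
  have key l : \sum_i a i * theta i p (E l p) = 0.
    have : (v *m map_mx (sfun_eval p) A) 0 l = 0 by rewrite vA mxE.
    rewrite mxE => vA0; rewrite -[RHS]vA0.
    under [RHS]eq_bigr => k _ do rewrite !mxE [sfun_eval p _]sfun_sumE mulr_sumr.
    rewrite [RHS]exchange_big/=; apply: eq_bigr => i _.
    by rewrite /a mulr_suml; apply: eq_bigr => k _; rewrite mulrA.
  have : \sum_i a i ^+ 2 = 0.
    have vkey : \sum_l v 0 l * (\sum_i a i * theta i p (E l p)) = 0.
      by rewrite big1// => l _; rewrite key mulr0.
    rewrite -[RHS]vkey.
    under [RHS]eq_bigr => l _ do rewrite mulr_sumr.
    rewrite [RHS]exchange_big/=; apply: eq_bigr => i _.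
    by rewrite expr2 {2}/a mulr_sumr; apply: eq_bigr => l _; rewrite mulrCA.
  move=> /eqP; rewrite psumr_eq0; last by move=> i _; exact: sqr_ge0.
  move=> /allP a0.
  have u0 : \sum_k v 0 k *: E k p = 0.
    apply: theta_inj => i; rewrite form1_sum.
    have /eqP : a i == 0 by have := a0 i (mem_index_enum _); rewrite sqrf_eq0.
    by move=> ai0; rewrite -[RHS]ai0; apply: eq_bigr => k _; rewrite form1Z.
  case/eqP: v0; apply/rowP => l; rewrite mxE.
  have ul : (\sum_k v 0 k *: E k p) (x l) = 0 by rewrite u0.
  rewrite -[RHS]ul tan_sumE (bigD1 l)// tanZE framep eqxx mulr1.
  rewrite big1 => [|k kl]; first exact: (esym (addr0 _)).
  by rewrite tanZE framep (negbTE kl) mulr0.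
have [d dE] := sfun_inv_near detA.
exists (\sum_k d * w k 0 * vf_deriv (E k) f); first exact: sfun_smooth.
have detN := sfun_near_neq0 detA.
apply: filterS3 frame dE detN => q [frameq decq] dq detq.
rewrite sfun_sumE {1}(decq (V q)) tan_sumE; apply: eq_bigr => k _.
rewrite tanZE !sfunME dq; congr (_ * _).
pose c : 'cV[R]_n := \col_k V q (x k).
(* These are the normal equations for the components [c] of [V] in the frame. *)
have Ac : map_mx (sfun_eval q) A *m c = map_mx (sfun_eval q) B.
  apply/colP => j; rewrite !mxE [RHS]sfun_sumE.
  under eq_bigr => l _ do rewrite !mxE [sfun_eval q _]sfun_sumE mulr_suml.
  rewrite exchange_big/=; apply: eq_bigr => i _.
  rewrite [in RHS](decq (V q)) form1_sum mulr_sumr.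
  by apply: eq_bigr => l _; rewrite form1Z mulrCA mulrC.
have /(congr1 (fun m : 'cV_n => m k 0)) : map_mx (sfun_eval q) w = (\det A) q *: c.
  rewrite /w map_mxM map_mx_adj -Ac mulmxA mul_adj_mx mul_scalar_mx.
  by rewrite det_map_mx.
rewrite [LHS]mxE [RHS]mxE [X in _ * X]mxE => wk.
by rewrite -[w k 0 q]/(sfun_eval q (w k 0)) wk mulKf.
Qed.
End Evaluation.

(** * Pullbacks, lifts and the Koszul formula *)

Section Pullback.
Context {R : realType} {m n : nat} {M : manifold R m} {N : manifold R n}.
Variable phi : smoothmap M N.
Implicit Types (p : M) (f : smoothfun N) (V W C : vfield M) (X Y E : vfield N).

Lemma differentialD p (u v : tangent p) :
  differential phi (u + v) = differential phi u + differential phi v.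
Proof. exact: tanP. Qed.

Lemma differentialZ p a (u : tangent p) :
  differential phi (a *: u) = a *: differential phi u.
Proof. exact: tanP. Qed.

Lemma differentialB p (u v : tangent p) :
  differential phi (u - v) = differential phi u - differential phi v.
Proof. exact: tanP. Qed.

Lemma differential0 p : differential phi (0 : tangent p) = 0.
Proof. exact: tanP. Qed.

Lemma near_preimage p (P : N -> Prop) :
  (\forall y \near phi p, P y) -> \forall q \near p, P (phi q).
Proof. exact: (@smap_continuous _ _ _ _ _ phi p P). Qed.

Lemma pullback_frame p : exists (x : 'I_n -> smoothfun N) (E : 'I_n -> vfield N),
  (forall k l, \forall y \near phi p, vf_deriv (E k) (x l) y = (k == l)%:R) /\
  \forall q \near p, forall v : tangent (phi q), v = \sum_k v (x k) *: E k (phi q).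
Proof.
have [x [E frame]] := local_frame (phi p); exists x, E; split=> [k l|].
  by apply: filterS frame => y [H _]; exact: H.
  by have := near_preimage frame; apply: filterS => q [_ dec]; exact: dec.
Qed.

Lemma is_smooth_pullback_tensor2 (T : tensor2 N) V W :
  is_smooth (fun p => T (phi p) (differential phi (V p)) (differential phi (W p))).
Proof.
apply: is_smooth_local => p; have [x [E [_ dec]]] := pullback_frame p.
exists (\sum_k \sum_l vf_deriv V (pullback phi (x k)) *
  vf_deriv W (pullback phi (x l)) * pullback phi (t2_app T (E k) (E l))).
  exact: sfun_smooth.
apply: filterS dec => q decq; rewrite sfun_sumE.
rewrite (decq (differential phi (V q))) tensor2_suml; apply: eq_bigr => k _.
rewrite (decq (differential phi (W q))) tensor2_sumr sfun_sumE.
by apply: eq_bigr => l _; rewrite tensor2Zl tensor2Zr mulrA.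
Qed.

Definition pullback_tensor2 (T : tensor2 N) : tensor2 M.
Proof.
exists (fun p u v => T (phi p) (differential phi u) (differential phi v)).
- by move=> p a u v w; rewrite differentialD differentialZ t2_linearl.
- by move=> p a u v w; rewrite differentialD differentialZ t2_linearr.
- exact: is_smooth_pullback_tensor2.
Defined.

Definition related V X := forall p, differential phi (V p) = X (phi p).

Lemma related_deriv V X f : related V X ->
  vf_deriv V (pullback phi f) = pullback phi (vf_deriv X f).
Proof.
by move=> VX; apply: sfunP => p; rewrite -[LHS]/(differential phi (V p) f) VX.
Qed.

Lemma related_bracket V W X Y : related V X -> related W Y ->
  related (bracket V W) (bracket X Y).
Proof.
move=> VX WY p; apply: tanP => f.
rewrite -[LHS]/(V p (vf_deriv W (pullback phi f)) - W p (vf_deriv V (pullback phi f))).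
rewrite (related_deriv _ VX) (related_deriv _ WY).
rewrite -[V p _]/(differential phi (V p) (vf_deriv Y f)) VX.
by rewrite -[W p _]/(differential phi (W p) (vf_deriv X f)) WY.
Qed.

Lemma related_pullback_tensor2 (T : tensor2 N) V W X Y :
  related V X -> related W Y ->
  t2_app (pullback_tensor2 T) V W = pullback phi (t2_app T X Y).
Proof. by move=> VX WY; apply: sfunP => p /=; rewrite VX WY. Qed.

(** The lift is chosen pointwise. It is smooth because the forms [d (x k \o phi)] and [eta], jointly
    injective, take smooth values on it: derivatives of [x k] along [X], pulled back, and [0]. *)
Lemma exists_lift (eta : form1 M) X :
  (forall p (v : tangent p), differential phi v = 0 -> eta p v = 0 -> v = 0) ->
  (forall p, exists v : tangent p, differential phi v = X (phi p) /\ eta p v = 0) ->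
  exists V, related V X /\ forall p, eta p (V p) = 0.
Proof.
move=> eta_inj lift; pose V p := sval (cid (lift p)).
have VX p : differential phi (V p) = X (phi p) by exact: (svalP (cid (lift p))).1.
have etaV p : eta p (V p) = 0 by exact: (svalP (cid (lift p))).2.
suff CV : forall f : smoothfun M, is_smooth (fun p => V p f) by exists (Vfield CV).
apply: smooth_section => p; have [x [E [_ /nbhs_singleton dec]]] := pullback_frame p.
have Cd (f : smoothfun M) :
  (forall p a (u v : tangent p), (a *: u + v) f = a * u f + v f) by [].
pose dform (f : smoothfun M) : form1 M := Form1 (Cd f) (fun A => vf_smooth A f).
(* [Some k] stands for the differential of the [k]-th pulled-back coordinate, [None] for [eta]. *)
exists (option 'I_n), (fun i => if i is Some k then dform (pullback phi (x k)) else eta).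
split=> [[k|]|v v0].
- have -> : (fun q => dform (pullback phi (x k)) q (V q)) = pullback phi (vf_deriv X (x k)).
    apply/funext => q; rewrite -[LHS]/(differential phi (V q) (x k)).
    by rewrite VX.
  exact: sfun_smooth.
- by have -> : (fun q => eta q (V q)) = fun=> 0; [exact/funext|exact: is_smooth_cst].
apply: eta_inj (v0 None).
by rewrite [LHS]dec big1// => k _; have := v0 (Some k) => /= ->; rewrite scale0r.
Qed.

End Pullback.

(** * The Koszul formula with torsion, and its pullback *)

Section Koszul.
Context {R : realType} {m n : nat} {M : manifold R m} {N : manifold R n}.
Implicit Types (D : connection N) (X Y E : vfield N).

Definition koszul_form (k : nat) (Q : manifold R k) (G : tensor2 Q)
    (V W C : vfield Q) : smoothfun Q :=
  vf_deriv V (t2_app G W C) + vf_deriv W (t2_app G V C) - vf_deriv C (t2_app G V W)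
  + t2_app G (bracket V W) C - t2_app G (bracket V C) W - t2_app G (bracket W C) V.

Definition metric_connection (g : tensor2 N) D := forall A B C,
  vf_deriv A (t2_app g B C) = t2_app g (D A B) C + t2_app g B (D A C).

(** The differences [D X Y - D Y X] are left unexpanded, so that the identity serves both the
    Levi-Civita connection and a metric connection with torsion. *)
Lemma metric_connection_koszul (g : tensor2 N) D X Y E p :
  (forall q (u v : tangent q), g q u v = g q v u) -> metric_connection g D ->
  vf_deriv X (t2_app g Y E) p + vf_deriv Y (t2_app g X E) p
  - vf_deriv E (t2_app g X Y) p
  + g p ((D X Y - D Y X) p) (E p) - g p ((D X E - D E X) p) (Y p)
  - g p ((D Y E - D E Y) p) (X p) = g p (D X Y p) (E p) *+ 2.
Proof.
move=> gC compat; rewrite !compat mulr2n !(sfunDE, sfunNE) !tensor2Bl /=.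
rewrite (gC p (Y p)) (gC p (X p) (D Y E p)) (gC p (X p) (D E Y p)).
ring.
Qed.

Lemma levi_civita_koszul (g : tensor2 N) D X Y E : is_metric g ->
  is_levi_civita g D -> koszul_form g X Y E = t2_app g (D X Y) E *+ 2.
Proof.
move=> [gC _] [compat torsion]; apply: sfunP => p; rewrite mulr2n.
have := metric_connection_koszul X Y E p gC compat.
by rewrite !torsion mulr2n.
Qed.

Variable phi : smoothmap M N.

(* [C] is not assumed to project to [N]: its projection is expanded in a local
   frame of [N], and the derivatives of the coefficients cancel. *)
Lemma koszul_pullback (g : tensor2 N) D V W C X Y : is_metric g ->
  is_levi_civita g D -> related phi V X -> related phi W Y ->
  forall p, koszul_form (pullback_tensor2 phi g) V W C p =
    g (phi p) (D X Y (phi p)) (differential phi (C p)) *+ 2.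
Proof.
move=> mg LC VX WY p; have [gC _] := mg.
have [x [E [delta dec]]] := pullback_frame phi p.
pose G := pullback_tensor2 phi g; pose y := phi p.
(* The components of the projection of [C]: functions on [M], not pulled back from [N]. *)
pose c k := vf_deriv C (pullback phi (x k)).
have decp := nbhs_singleton dec.
have derivG (U A : vfield M) (B : vfield N) (Z : vfield N) :
    related phi U Z -> related phi A B ->
    vf_deriv U (t2_app G A C) p = \sum_k (U p (c k) * g y (B y) (E k y) +
      c k p * vf_deriv Z (t2_app g B (E k)) y).
  move=> UZ AB.
  rewrite -[LHS]/(U p (t2_app G A C)).
  have -> : U p (t2_app G A C) = U p (\sum_k c k * pullback phi (t2_app g B (E k))).
    apply: tangent_local; apply: filterS dec => q decq.
    rewrite sfun_sumE /= AB (decq (differential phi (C q))) tensor2_sumr.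
    by apply: eq_bigr => k _; rewrite tensor2Zr.
  rewrite tangent_sum; apply: eq_bigr => k _; rewrite tan_leibniz.
  rewrite -[U p (pullback _ _)]/(vf_deriv U (pullback phi (t2_app g B (E k))) p).
  by rewrite (related_deriv _ UZ) /= addrC mulrC.
have brack (U : vfield M) (Z : vfield N) : related phi U Z ->
    differential phi (bracket U C p) =
      \sum_k (U p (c k) *: E k y + c k p *: bracket Z (E k) y).
  move=> UZ.
  (* [E l (x k)] is constant near [y], so only the second half of the bracket contributes. *)
  have brE l : bracket Z (E l) y = \sum_k - (E l y (vf_deriv Z (x k))) *: E k y.
    rewrite [LHS]decp; apply: eq_bigr => k _; congr (_ *: _).
    rewrite -[LHS]/(Z y (vf_deriv (E l) (x k)) - E l y (vf_deriv Z (x k))).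
    have -> : Z y (vf_deriv (E l) (x k)) = 0; last by rewrite add0r.
    rewrite -(tangent_cst (Z y) (l == k)%:R); apply: tangent_local.
    exact: delta.
  rewrite [LHS]decp.
  under [RHS]eq_bigr => l _ do rewrite brE scaler_sumr.
  rewrite big_split/= [X in _ + X]exchange_big/= -big_split/=; apply: eq_bigr => k _.
  rewrite (eq_bigr (fun l => (c l p * - E l y (vf_deriv Z (x k))) *: E k y)); last first.
    by move=> l _; rewrite scalerA.
  rewrite -scaler_suml -scalerDl; congr (_ *: _).
  rewrite -[LHS]/(U p (c k) - C p (vf_deriv U (pullback phi (x k)))).
  rewrite (related_deriv _ UZ); congr (_ + _).
  rewrite -[C p _]/(differential phi (C p) (vf_deriv Z (x k))).
  rewrite {1}(decp (differential phi (C p))) tan_sumE -sumrN; apply: eq_bigr => l _.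
  by rewrite tanZE mulrN.
have VWX := related_pullback_tensor2 g VX WY.
rewrite /koszul_form !sfunDE !sfunNE (derivG V W Y X)// (derivG W V X Y)//.
rewrite VWX -[vf_deriv C _ p]/(differential phi (C p) (t2_app g X Y)).
rewrite -[t2_app _ _ C p]/(g y _ _) (related_bracket VX WY).
rewrite -[t2_app _ (bracket V C) W p]/(g y _ _) -[t2_app _ (bracket W C) V p]/(g y _ _).
rewrite (brack V X)// (brack W Y)// VX WY.
have Cp : differential phi (C p) = \sum_k c k p *: E k y := decp _.
rewrite Cp tan_sumE !tensor2_sumr !tensor2_suml -sumrMnl -!sumrN -!big_split/=.
apply: eq_bigr => k _.
(* What remains for each [k] is [c k p] times the Koszul formula on [N] with third field [E k]. *)
have := congr1 (fun f : smoothfun N => c k p * f y) (levi_civita_koszul X Y (E k) mg LC).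
rewrite /koszul_form mulr2n !(sfunDE, sfunNE) /= => H.
rewrite !(tensor2Dl, tensor2Zl, tensor2Zr) (gC y (E k y) (Y y)) (gC y (E k y) (X y)).
rewrite -/y; apply/eqP; rewrite -subr_eq0; apply/eqP.
move/eqP: H; rewrite -subr_eq0 => /eqP H; rewrite -[RHS]H.
ring.
Qed.

End Koszul.

(** * Lie derivatives and Killing fields *)

Section LieDerivative.
Context {R : realType} {n : nat} {N : manifold R n}.
Implicit Types (A B C Z : vfield N) (f : smoothfun N) (g T : tensor2 N).

Lemma bracketDr Z A B : bracket Z (A + B) = bracket Z A + bracket Z B.
Proof.
apply: vfP => p; apply: tanP => f.
rewrite -[LHS]/(Z p (vf_deriv A f + vf_deriv B f) - (A p + B p) (vf_deriv Z f)).
rewrite Defs.tanD tanDE vfDE tanDE /=; ring.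
Qed.

Lemma bracketZr Z f A :
  bracket Z (f *: A) = vf_deriv Z f *: A + f *: bracket Z A.
Proof.
apply: vfP => p; apply: tanP => h.
rewrite -[LHS]/(Z p (f * vf_deriv A h) - f p * A p (vf_deriv Z h)).
rewrite tan_leibniz /=; ring.
Qed.

Lemma bracketZ0 Z : bracket Z Z = 0.
Proof. by apply: vfP => p; apply: tanP => h /=; rewrite subrr. Qed.

Lemma bracket_deriv A B f :
  vf_deriv (bracket A B) f = vf_deriv A (vf_deriv B f) - vf_deriv B (vf_deriv A f).
Proof. exact: sfunP. Qed.

Lemma vf_derivB A f h : vf_deriv A (f - h) = vf_deriv A f - vf_deriv A h.
Proof. by apply: sfunP => p /=; exact: tangentB. Qed.

Lemma vf_derivD A f h : vf_deriv A (f + h) = vf_deriv A f + vf_deriv A h.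
Proof. by apply: sfunP => p /=; exact: Defs.tanD. Qed.

Lemma jacobi Z A B :
  bracket Z (bracket A B) = bracket (bracket Z A) B + bracket A (bracket Z B).
Proof.
apply: vfP => p; apply: tanP => f.
rewrite -[LHS]/(vf_deriv (bracket Z (bracket A B)) f p).
rewrite -[RHS]/((vf_deriv (bracket (bracket Z A) B) f +
                vf_deriv (bracket A (bracket Z B)) f) p).
by congr sfun_val; rewrite !bracket_deriv !vf_derivB; ring.
Qed.

Lemma metric_fieldP g A B : is_metric g ->
  (forall C, t2_app g A C = t2_app g B C) -> A = B.
Proof.
move=> [_ nondeg] gAB; apply: vfP => p; apply/eqP; rewrite -subr_eq0; apply/eqP.
apply: nondeg => v; have [C <-] := extend_tangent v.
rewrite tensor2Bl; apply/eqP; rewrite subr_eq0; apply/eqP.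
by have := congr1 (fun f : smoothfun N => f p) (gAB C).
Qed.

Definition killing g Z := forall A B, vf_deriv Z (t2_app g A B) =
  t2_app g (bracket Z A) B + t2_app g A (bracket Z B).

Lemma killing_skew g D Z A B : is_levi_civita g D -> killing g Z ->
  t2_app g (D A Z) B + t2_app g A (D B Z) = 0.
Proof.
move=> [compat torsion] /(_ A B); rewrite compat -!torsion => H.
apply: sfunP => p; have := congr1 (fun f : smoothfun N => f p) H.
rewrite !sfunDE /= tensor2Bl tensor2Br => {}H.
apply/eqP; rewrite -[X in _ == X](subrr (g p (D Z A p) (B p) + g p (A p) (D Z B p))).
by rewrite {2}H; apply/eqP; ring.
Qed.

(* The Lie derivative of the connection is symmetric by the Jacobi identity and
   skew in its last two arguments once lowered by [g], hence zero. *)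
Lemma killing_connection g D Z A B : is_metric g -> is_levi_civita g D ->
  killing g Z ->
  bracket Z (D A B) = D (bracket Z A) B + D A (bracket Z B).
Proof.
move=> mg [compat torsion] kg; have gC := mg.1.
pose L X Y := bracket Z (D X Y) - D (bracket Z X) Y - D X (bracket Z Y).
have Lsym X Y : L X Y = L Y X.
  apply/eqP; rewrite -subr_eq0 /L.
  have -> : bracket Z (D X Y) - D (bracket Z X) Y - D X (bracket Z Y) -
      (bracket Z (D Y X) - D (bracket Z Y) X - D Y (bracket Z X)) =
    bracket Z (D X Y - D Y X) - (D (bracket Z X) Y - D Y (bracket Z X)) -
      (D X (bracket Z Y) - D (bracket Z Y) X).
    have -> : bracket Z (D X Y - D Y X) = bracket Z (D X Y) - bracket Z (D Y X).
      apply: (addIr (bracket Z (D Y X))); rewrite -bracketDr !subrK//.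
    apply: vfP => p; apply: tanP => f.
    by rewrite !(vfDE, vfNE, tanDE, tanNE); ring.
  by rewrite !torsion jacobi; apply/eqP; rewrite [X in X - _ - _]addrC addrK subrr.
(* The commutator of [Z] and [X] acting on [g(Y, C)] is expanded by the Killing equation and by
   metricity of [D], then compared with the derivative along [bracket Z X]. *)
have Lskew X Y C p : g p (L X Y p) (C p) = - g p (Y p) (L X C p).
  have H := congr1 (fun f : smoothfun N => f p) (bracket_deriv Z X (t2_app g Y C)).
  rewrite (compat (bracket Z X)) (compat X Y C) (kg Y C) !vf_derivD !kg !compat in H.
  rewrite !(sfunDE, sfunNE) /= in H.
  have -> : L X Y p = bracket Z (D X Y) p - D (bracket Z X) Y p - D X (bracket Z Y) p by [].
  have -> : L X C p = bracket Z (D X C) p - D (bracket Z X) C p - D X (bracket Z C) p by [].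
  rewrite !(tensor2Bl, tensor2Br) /=.
  apply/eqP; rewrite -subr_eq0 opprK; apply/eqP.
  move/eqP: H; rewrite -subr_eq0 => /eqP H; rewrite -[RHS]oppr0 -[in RHS]H.
  ring.
have L0 : L A B = 0.
  apply: (metric_fieldP mg) => C; apply: sfunP => p /=; rewrite tensor20l.
  have H : g p (L A B p) (C p) = - g p (L A B p) (C p).
    rewrite {1}Lsym Lskew gC Lsym Lskew opprK gC Lsym Lskew.
    by rewrite gC.
  move: H; lra.
by apply/eqP; rewrite -subr_eq0 opprD addrA -[X in X == 0]/(L A B) L0.
Qed.

End LieDerivative.

(** * The connection nabla^S on the hyper-Kaehler manifold *)

Section HyperKaehlerQuotient.
Context {R : realType} {n : nat} {N : manifold R n}.
Variables (g : tensor2 N) (D : connection N) (I1 I2 I3 : endofield N).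
Variables (Z : vfield N) (fZ : smoothfun N).
Hypotheses (hyperkaehlerN : is_hyperkaehler g D I1 I2 I3)
  (rotatingZ : is_rotating g I1 I2 I3 Z)
  (momentZ : is_moment_map g I1 Z fZ)
  (fZ_neq0 : forall p, fZ p <> 0)
  (fH_neq0 : forall p, fH g Z fZ p <> 0).
Implicit Types (p : N) (A B C : vfield N).

Let metric_g : is_metric g. Proof. by case: hyperkaehlerN => [[]]. Qed.
Let LC : is_levi_civita g D. Proof. by case: hyperkaehlerN => [[]]. Qed.
Let gC p (u v : tangent p) : g p u v = g p v u. Proof. exact: metric_g.1. Qed.

(** * Quaternionic relations, Lie derivatives of the complex structures, and [I_H] *)

Lemma endofieldD (J : endofield N) p u v : J p (u + v) = J p u + J p v.
Proof. by have := ef_linear J 1 u v; rewrite !scale1r. Qed.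

Lemma endofield0 (J : endofield N) p : J p 0 = 0.
Proof. by apply: (addrI (J p 0)); rewrite -endofieldD !addr0. Qed.

Lemma endofieldZ (J : endofield N) p a u : J p (a *: u) = a *: J p u.
Proof. by rewrite -[a *: u]addr0 ef_linear endofield0 addr0. Qed.

Lemma endofieldN (J : endofield N) p u : J p (- u) = - J p u.
Proof. by rewrite -scaleN1r endofieldZ scaleN1r. Qed.

Let I11 p u : I1 p (I1 p u) = - u.
Proof. by case: hyperkaehlerN => _ [[]]. Qed.
Let I22 p u : I2 p (I2 p u) = - u.
Proof. by case: hyperkaehlerN => _ [_ []]. Qed.
Let I33 p u : I3 p (I3 p u) = - u.
Proof. by case: hyperkaehlerN => _ [_ _ []]. Qed.
Let I12 p u : I1 p (I2 p u) = I3 p u.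
Proof. by case: hyperkaehlerN. Qed.
Let I21 p u : I2 p (I1 p u) = - I3 p u.
Proof. by case: hyperkaehlerN. Qed.
Let I13 p u : I1 p (I3 p u) = - I2 p u.
Proof. by rewrite -I12 I11. Qed.
Let I32 p u : I3 p (I2 p u) = - I1 p u.
Proof. by rewrite -I12 I22 endofieldN. Qed.
Let I23 p u : I2 p (I3 p u) = I1 p u.
Proof. by rewrite -I12 I21 I32 opprK. Qed.
Let I31 p u : I3 p (I1 p u) = I2 p u.
Proof. by rewrite -[I3 p _]opprK -I21 I11 endofieldN opprK. Qed.

Let skewI (J : endofield N) : is_parallel_complex g D J ->
  forall p u v, g p u (J p v) = - g p (J p u) v.
Proof.
by move=> [JJ gJ _] p u v; rewrite -(gJ p u) JJ tensor2Nr.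
Qed.
Let skew1 p u v : g p u (I1 p v) = - g p (I1 p u) v.
Proof. by apply: skewI; case: hyperkaehlerN => _ []. Qed.
Let skew2 p u v : g p u (I2 p v) = - g p (I2 p u) v.
Proof. by apply: skewI; case: hyperkaehlerN => _ []. Qed.
Let skew3 p u v : g p u (I3 p v) = - g p (I3 p u) v.
Proof. by apply: skewI; case: hyperkaehlerN => _ []. Qed.
Let par1 : is_parallel D I1. Proof. by case: hyperkaehlerN => _ [[]]. Qed.
Let par2 : is_parallel D I2. Proof. by case: hyperkaehlerN => _ [_ []]. Qed.
Let par3 : is_parallel D I3. Proof. by case: hyperkaehlerN => _ [_ _ []]. Qed.

Let killZ : killing g Z.
Proof.
move=> A B; case: rotatingZ => /(_ A B) + _ _ _; rewrite /lie_tensor2.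
by move=> /eqP; rewrite subr_eq0 subr_eq addrC => /eqP.
Qed.

(** Since [Z] is Killing and [g] nondegenerate, the Lie derivative of the form of [J] determines
    that of [J] itself. *)
Let lieI (J K : endofield N) :
  (forall A B, lie_tensor2 Z (t2_endo g J) A B = t2_app (t2_endo g K) A B) ->
  forall A, bracket Z (ef_app J A) = ef_app J (bracket Z A) + ef_app K A.
Proof.
move=> lieJ A; apply: (metric_fieldP metric_g) => C; apply: sfunP => p.
have := congr1 (fun f : smoothfun N => f p) (lieJ A C).
rewrite /lie_tensor2 -[t2_app (t2_endo g J) A C]/(t2_app g (ef_app J A) C) killZ.
rewrite !(sfunDE, sfunNE) /= tensor2Dl => <-; ring.
Qed.

Let lie1 A : bracket Z (ef_app I1 A) = ef_app I1 (bracket Z A).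
Proof.
apply: (metric_fieldP metric_g) => C; apply: sfunP => p.
case: rotatingZ => _ /(_ A C) /(congr1 (fun f : smoothfun N => f p)) + _ _.
rewrite /lie_tensor2 -[t2_app (t2_endo g I1) A C]/(t2_app g (ef_app I1 A) C) killZ.
rewrite !(sfunDE, sfunNE) /= => /eqP; rewrite addrAC addrK subr_eq0 => /eqP.
by [].
Qed.
Let lie2 A : bracket Z (ef_app I2 A) = ef_app I2 (bracket Z A) + ef_app I3 A.
Proof. by apply: lieI; case: rotatingZ. Qed.
Let lie3 A : bracket Z (ef_app I3 A) = ef_app I3 (bracket Z A) - ef_app I2 A.
Proof.
have lie3 (B C : vfield N) : lie_tensor2 Z (t2_endo g I3) B C = - t2_app (t2_endo g I2) B C.
  by case: rotatingZ.
apply: (metric_fieldP metric_g) => C; apply: sfunP => p.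
have := congr1 (fun f : smoothfun N => f p) (lie3 A C).
rewrite /lie_tensor2 -[t2_app (t2_endo g I3) A C]/(t2_app g (ef_app I3 A) C) killZ.
rewrite !(sfunDE, sfunNE) /= tensor2Bl => H.
apply/eqP; rewrite -subr_eq0; apply/eqP; move/eqP: H; rewrite -subr_eq0 => /eqP H.
rewrite -[RHS]H; ring.
Qed.

(** Torsion-freeness and parallelism give [[Z, J A] = J (D Z A) - D (J A) Z]; comparing with [J
    [Z, A] + K] cancels the terms [J (D Z A)]. *)
Let DJZ (J : endofield N) A K p : is_parallel D J ->
  bracket Z (ef_app J A) = ef_app J (bracket Z A) + K ->
  D (ef_app J A) Z p = J p (D A Z p) - K p.
Proof.
move=> parJ /(congr1 (fun X : vfield N => X p)).
rewrite -!LC.2 parJ.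
rewrite !(vfDE, vfNE) /= endofieldD endofieldN => H.
have {}H : - D (ef_app J A) Z p = - J p (D A Z p) + K p.
  by apply: (addrI (J p (D Z A p))); rewrite addrA.
by rewrite -[LHS]opprK H opprD opprK.
Qed.

Let h A := IH D I1 Z A.

Lemma IHE A p : h A p = I1 p (A p) + D A Z p *+ 2.
Proof. by rewrite /h /IH mulr2n vfDE vfDE mulr2n. Qed.

Let DI1Z A p : D (ef_app I1 A) Z p = I1 p (D A Z p).
Proof. by rewrite (@DJZ _ _ 0)// ?subr0// lie1 addr0. Qed.
Let DI2Z A p : D (ef_app I2 A) Z p = I2 p (D A Z p) - I3 p (A p).
Proof. by rewrite (DJZ _ par2 (lie2 A)). Qed.
Let DI3Z A p : D (ef_app I3 A) Z p = I3 p (D A Z p) + I2 p (A p).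
Proof. by rewrite (DJZ _ par3 (lie3 A)) vfNE opprK. Qed.

Lemma IH_I1 A p : h (ef_app I1 A) p = I1 p (h A p).
Proof. by rewrite !IHE DI1Z endofieldD mulr2n endofieldD -mulr2n. Qed.

(** Moving [I_2] out of [2 D Z] costs [- 2 I_3], exactly what turns [I_1 I_2 = I_3] into
    [I_2 I_1 = - I_3]. *)
Lemma IH_I2 A p : h (ef_app I2 A) p = I2 p (h A p).
Proof.
rewrite !IHE DI2Z endofieldD I12 I21 !mulr2n endofieldD.
apply: tanP => f; rewrite !(tanDE, tanNE); ring.
Qed.

Lemma IH_I3 A p : h (ef_app I3 A) p = I3 p (h A p).
Proof.
rewrite !IHE DI3Z endofieldD I13 I31 !mulr2n endofieldD.
apply: tanP => f; rewrite !(tanDE, tanNE); ring.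
Qed.

Lemma IH_skew A B p : g p (h A p) (B p) = - g p (A p) (h B p).
Proof.
have H : g p (D A Z p) (B p) + g p (A p) (D B Z p) = 0.
  by have /(congr1 (fun f : smoothfun N => f p)) := killing_skew A B LC killZ.
rewrite !IHE !mulr2n !(tensor2Dl, tensor2Dr) skew1.
by move/eqP: H; rewrite addr_eq0 => /eqP ->; ring.
Qed.

(** The exterior derivative of [g(Z, .)] on [A], [B] is [g(D A Z, B) - g(D B Z, A)], which is
    [2 g(D A Z, B)] by the Killing equation. *)
Lemma omegaH_IH omegaH A B p : is_omegaH g I1 Z omegaH ->
  omegaH p (A p) (B p) = g p (h A p) (B p).
Proof.
move=> /(_ A B)/(congr1 (fun f : smoothfun N => f p)).
have -> : t2_app omegaH A B p = omegaH p (A p) (B p) by [].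
move=> ->; rewrite IHE /ext_d.
rewrite -[f1_app _ A]/(t2_app g Z A) -[f1_app _ B]/(t2_app g Z B).
rewrite -[f1_app _ (bracket A B)]/(t2_app g Z (bracket A B)) !LC.1 -LC.2.
have H : g p (D A Z p) (B p) + g p (A p) (D B Z p) = 0.
  by have /(congr1 (fun f : smoothfun N => f p)) := killing_skew A B LC killZ.
rewrite !(sfunDE, sfunNE) /= mulr2n !(tensor2Dl, tensor2Br).
rewrite (gC (Z p) (D A B p)); rewrite (gC (A p) (D B Z p)) in H.
apply/eqP; rewrite -subr_eq0; apply/eqP; rewrite -[RHS]oppr0 -[in RHS]H; ring.
Qed.

Lemma vf_deriv_inv (f : smoothfun N) (f0 : forall p, f p != 0) A p :
  A p (sfun_inv f0) = - (f p)^-1 ^+ 2 * A p f.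
Proof.
have H : A p (f * sfun_inv f0) = 0.
  rewrite -(tangent1 (A p)); congr tan_val; apply: sfunP => q.
  by rewrite sfunME /= divff.
move: H; rewrite tan_leibniz /= => H.
apply: (mulfI (f0 p)); apply: (addIr ((f p)^-1 * A p f)); rewrite H.
by field; exact: f0.
Qed.

Lemma vf_deriv_moment A p : A p fZ = - g p (I1 p (Z p)) (A p).
Proof. by apply: oppr_inj; rewrite opprK -momentZ. Qed.

Let skewZ1 p : g p (I1 p (Z p)) (Z p) = 0.
Proof. by have := gC (I1 p (Z p)) (Z p); rewrite skew1; lra. Qed.
Let skewZ2 p : g p (I2 p (Z p)) (Z p) = 0.
Proof. by have := gC (I2 p (Z p)) (Z p); rewrite skew2; lra. Qed.
Let skewZ3 p : g p (I3 p (Z p)) (Z p) = 0.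
Proof. by have := gC (I3 p (Z p)) (Z p); rewrite skew3; lra. Qed.

Lemma invariant_fZ : vf_deriv Z fZ = 0.
Proof. by apply: sfunP => p /=; rewrite vf_deriv_moment skewZ1 oppr0. Qed.

Lemma invariant_fH : vf_deriv Z (fH g Z fZ) = 0.
Proof.
rewrite vf_derivD invariant_fZ killZ bracketZ0 add0r.
by apply: sfunP => p; rewrite sfunDE /= tensor20l tensor20r addr0.
Qed.

Lemma fZ_unit p : fZ p != 0. Proof. exact/eqP. Qed.
Lemma fH_unit p : fH g Z fZ p != 0. Proof. exact/eqP. Qed.

Let invZ := sfun_inv fZ_unit.
Let invH := sfun_inv fH_unit.

Let invariant_invZ : vf_deriv Z invZ = 0.
Proof.
apply: sfunP => p; rewrite -[LHS]/(Z p invZ) vf_deriv_inv.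
by rewrite -[Z p fZ]/(vf_deriv Z fZ p) invariant_fZ mulr0.
Qed.
Let invariant_invH : vf_deriv Z invH = 0.
Proof.
apply: sfunP => p; rewrite -[LHS]/(Z p invH) vf_deriv_inv.
by rewrite -[Z p (fH _ _ _)]/(vf_deriv Z (fH g Z fZ) p) invariant_fH mulr0.
Qed.

(** * The tensor [S] and the torsion of [D + S] *)

Lemma sum_quat (V : nmodType) (F : endofield N -> V) :
  \sum_(mu < 4) F (quat I1 I2 I3 mu) = F ef_id + F I1 + F I2 + F I3.
Proof. by rewrite !big_ord_recl big_ord0 addr0 !addrA. Qed.

(** Twice the summand of [S] belonging to [J], built from module operations on fields so that
    smoothness is automatic, as the definition of a connection demands. *)
Let Sterm (J : endofield N) A B : vfield N :=
  (invH * t2_app g (ef_app J (h A)) B) *: ef_app J Z -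
  invZ *: (t2_app g (ef_app J Z) A *: ef_app J (ef_app I1 B) +
           t2_app g (ef_app J Z) B *: ef_app J (ef_app I1 A)).

Definition Sfield A B : vfield N := sfun_cst 2^-1 *:
  (Sterm ef_id A B + Sterm I1 A B + Sterm I2 A B + Sterm I3 A B).

Let Sterm_at J A B p : Sterm J A B p =
  ((fH g Z fZ p)^-1 * g p (J p (h A p)) (B p)) *: J p (Z p) -
  (fZ p)^-1 *: (g p (J p (Z p)) (A p) *: J p (I1 p (B p)) +
                g p (J p (Z p)) (B p) *: J p (I1 p (A p))).
Proof. by rewrite /Sterm vfDE vfNE !vfZE vfDE !vfZE. Qed.

Lemma SfieldE A B p : Sfield A B p = S_at g D I1 I2 I3 Z fZ A B p.
Proof.
rewrite /S_at (eq_bigr (fun mu => Sterm (quat I1 I2 I3 mu) A B p)) => [|mu _].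
  by rewrite (sum_quat (fun J => Sterm J A B p)).
by rewrite Sterm_at.
Qed.

Let a0 A p := g p (Z p) (A p).
Let a1 A p := g p (I1 p (Z p)) (A p).
Let a2 A p := g p (I2 p (Z p)) (A p).
Let a3 A p := g p (I3 p (Z p)) (A p).

Lemma Sfield_quat A B p : Sfield A B p = 2^-1 *: (
  (fH g Z fZ p)^-1 *: (g p (h A p) (B p) *: Z p + g p (I1 p (h A p)) (B p) *: I1 p (Z p) +
    g p (I2 p (h A p)) (B p) *: I2 p (Z p) + g p (I3 p (h A p)) (B p) *: I3 p (Z p)) +
  (fZ p)^-1 *: ((a1 A p *: B p + a1 B p *: A p) -
    (a0 A p *: I1 p (B p) + a0 B p *: I1 p (A p)) +
    (a2 A p *: I3 p (B p) + a2 B p *: I3 p (A p)) -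
    (a3 A p *: I2 p (B p) + a3 B p *: I2 p (A p)))).
Proof.
have sumE (X0 X1 X2 X3 : vfield N) :
  (X0 + X1 + X2 + X3) p = X0 p + X1 p + X2 p + X3 p by [].
rewrite /Sfield vfZE sumE !Sterm_at !I11 !I21 !I31 /a0 /a1 /a2 /a3.
rewrite -[ef_id p (h A p)]/(h A p) -[ef_id p (Z p)]/(Z p).
rewrite -[ef_id p (I1 p (A p))]/(I1 p (A p)) -[ef_id p (I1 p (B p))]/(I1 p (B p)).
move: (h A p) => hA; apply: tanP => f; rewrite !(tanDE, tanNE, tanZE).
rewrite -[sfun_cst _ p]/(2^-1 : R); ring.
Qed.

Let hD f A B : h (f *: A + B) = f *: h A + h B.
Proof.
apply: vfP => p; rewrite IHE [RHS]vfDE vfZE !IHE conn_linear !vfDE !vfZE ef_linear.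
 apply: tanP => k.
by rewrite !mulr2n !(tanDE, tanZE); ring.
Qed.

Let Sterm_linearl J f A B C : Sterm J (f *: A + B) C = f *: Sterm J A C + Sterm J B C.
Proof.
apply: vfP => p; rewrite [RHS]vfDE vfZE !Sterm_at hD; move: (h A) (h B) => hA hB.
rewrite !(vfDE, vfZE) !endofieldD !endofieldZ.
rewrite !(tensor2Dl, tensor2Dr, tensor2Zl, tensor2Zr).
apply: tanP => k; rewrite !(tanDE, tanNE, tanZE); ring.
Qed.

Let Sterm_linearr J f A B C : Sterm J A (f *: B + C) = f *: Sterm J A B + Sterm J A C.
Proof.
apply: vfP => p; rewrite [RHS]vfDE vfZE !Sterm_at; move: (h A) => hA.
rewrite !(vfDE, vfZE) !endofieldD !endofieldZ.
rewrite !(tensor2Dl, tensor2Dr, tensor2Zl, tensor2Zr).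
apply: tanP => k; rewrite !(tanDE, tanNE, tanZE); ring.
Qed.

Let Sfield_linearl f A B C : Sfield (f *: A + B) C = f *: Sfield A C + Sfield B C.
Proof.
rewrite /Sfield !Sterm_linearl.
move: (Sterm ef_id A C) (Sterm I1 A C) (Sterm I2 A C) (Sterm I3 A C) => X0 X1 X2 X3.
move: (Sterm ef_id B C) (Sterm I1 B C) (Sterm I2 B C) (Sterm I3 B C) => Y0 Y1 Y2 Y3.
apply: vfP => p; rewrite !(vfDE, vfZE); apply: tanP => k; rewrite !(tanDE, tanZE); ring.
Qed.

Let Sfield_linearr f A B C : Sfield A (f *: B + C) = f *: Sfield A B + Sfield A C.
Proof.
rewrite /Sfield !Sterm_linearr.
move: (Sterm ef_id A C) (Sterm I1 A C) (Sterm I2 A C) (Sterm I3 A C) => X0 X1 X2 X3.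
move: (Sterm ef_id A B) (Sterm I1 A B) (Sterm I2 A B) (Sterm I3 A B) => Y0 Y1 Y2 Y3.
apply: vfP => p; rewrite !(vfDE, vfZE); apply: tanP => k; rewrite !(tanDE, tanZE); ring.
Qed.

Definition nablaS : connection N.
Proof.
exists (fun A B => D A B + Sfield A B) => [f A B C|A B C|f A B].
- by rewrite conn_linear Sfield_linearl scalerDr addrACA.
- have := Sfield_linearr 1 A B C; rewrite !scale1r => ->.
  by rewrite conn_additive addrACA.
- have S0 : Sfield A 0 = 0.
    by have := Sfield_linearr (-1) A 0 0; rewrite scaler0 addr0 scaleN1r addNr.
  have SZ : Sfield A (f *: B) = f *: Sfield A B.
    by rewrite -[f *: B]addr0 Sfield_linearr S0 addr0.
  by rewrite conn_leibniz SZ scalerDr addrA.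
Defined.

Lemma nablaSE A B : nablaS A B = D A B + Sfield A B. Proof. by []. Qed.

(** The terms with [1 / f_Z] are symmetric in [A], [B]. For [J = I_1, I_2, I_3] so is
    [g(J I_H A, B)], as [J] and [I_H] are skew and commute; only the skew [g(I_H A, B)] survives. *)
Lemma nablaS_torsion A B p :
  (nablaS A B - nablaS B A) p =
  bracket A B p + ((fH g Z fZ p)^-1 * g p (h A p) (B p)) *: Z p.
Proof.
have E1 : g p (I1 p (h B p)) (A p) = g p (I1 p (h A p)) (B p).
  by rewrite -IH_I1 IH_skew -[ef_app I1 B p]/(I1 p (B p)) gC skew1 opprK.
have E2 : g p (I2 p (h B p)) (A p) = g p (I2 p (h A p)) (B p).
  by rewrite -IH_I2 IH_skew -[ef_app I2 B p]/(I2 p (B p)) gC skew2 opprK.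
have E3 : g p (I3 p (h B p)) (A p) = g p (I3 p (h A p)) (B p).
  by rewrite -IH_I3 IH_skew -[ef_app I3 B p]/(I3 p (B p)) gC skew3 opprK.
have E0 : g p (h B p) (A p) = - g p (h A p) (B p) by rewrite IH_skew gC.
have nablaSB X Y : (D A B + X - (D B A + Y)) p = (D A B - D B A) p + (X p - Y p).
  by apply: tanP => f; rewrite !(vfDE, vfNE, tanDE, tanNE); ring.
rewrite !nablaSE nablaSB LC.2; congr (_ + _).
rewrite !Sfield_quat E0 E1 E2 E3; move: (h A p) (h B p) => hA hB.
move: (fH g Z fZ p)^-1 (fZ p)^-1 => iH iZ.
by apply: tanP => f; rewrite !(tanDE, tanNE, tanZE); field.
Qed.

(** * The elementary deformation and metricity of [D + S] *)

Lemma gHE p u v : gH g I1 I2 I3 Z fZ u v =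
  (fZ p)^-1 * g p u v + (fZ p)^-1 ^+ 2 * (g p (Z p) u * g p (Z p) v +
   g p (I1 p (Z p)) u * g p (I1 p (Z p)) v + g p (I2 p (Z p)) u * g p (I2 p (Z p)) v +
   g p (I3 p (Z p)) u * g p (I3 p (Z p)) v).
Proof.
rewrite /gH exprVn; congr (_ + _ * _).
rewrite (eq_bigr (fun mu => g p (quat I1 I2 I3 mu p (Z p)) u *
  g p (quat I1 I2 I3 mu p (Z p)) v)) => [|//].
by rewrite (sum_quat (fun J => g p (J p (Z p)) u * g p (J p (Z p)) v)).
Qed.

Let gHs A B : smoothfun N := invZ * t2_app g A B + invZ ^+ 2 *
  (t2_app g Z A * t2_app g Z B + t2_app g (ef_app I1 Z) A * t2_app g (ef_app I1 Z) B +
   t2_app g (ef_app I2 Z) A * t2_app g (ef_app I2 Z) B +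
   t2_app g (ef_app I3 Z) A * t2_app g (ef_app I3 Z) B).

Let gHsE A B p : gHs A B p = gH g I1 I2 I3 Z fZ (A p) (B p).
Proof. by rewrite gHE /gHs !expr2. Qed.

Definition gH_tensor2 : tensor2 N.
Proof.
exists (@gH R n N g I1 I2 I3 Z fZ) => [p a u v w|p a u v w|A B].
- by rewrite !gHE !(tensor2Dr, tensor2Zr, tensor2Dl, tensor2Zl); ring.
- by rewrite !gHE !(tensor2Dr, tensor2Zr); ring.
- have -> : (fun p => gH g I1 I2 I3 Z fZ (A p) (B p)) = gHs A B.
    by apply/funext => p; rewrite gHsE.
  exact: sfun_smooth.
Defined.

Lemma gH_sym p u v : gH_tensor2 p u v = gH_tensor2 p v u.
Proof. by rewrite [LHS]gHE [RHS]gHE (gC u v); ring. Qed.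

Let deriv_alpha (J : endofield N) A B p : is_parallel D J ->
  A p (t2_app g (ef_app J Z) B) =
  g p (J p (D A Z p)) (B p) + g p (J p (Z p)) (D A B p).
Proof.
move=> parJ; rewrite -[LHS]/(vf_deriv A (t2_app g (ef_app J Z) B) p) LC.1 parJ.
by [].
Qed.

(* The value at [p] of [Sfield A B] when [A], [B], [I_H A] take the values
   [u], [v], [hu]. *)
Let Sq p (hu u v : tangent p) : tangent p := 2^-1 *: (
  (fH g Z fZ p)^-1 *: (g p hu v *: Z p + g p (I1 p hu) v *: I1 p (Z p) +
    g p (I2 p hu) v *: I2 p (Z p) + g p (I3 p hu) v *: I3 p (Z p)) +
  (fZ p)^-1 *: ((g p (I1 p (Z p)) u *: v + g p (I1 p (Z p)) v *: u) -
    (g p (Z p) u *: I1 p v + g p (Z p) v *: I1 p u) +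
    (g p (I2 p (Z p)) u *: I3 p v + g p (I2 p (Z p)) v *: I3 p u) -
    (g p (I3 p (Z p)) u *: I2 p v + g p (I3 p (Z p)) v *: I2 p u))).

(** The [I_mu Z] are [g]-orthogonal of square norm [f_H - f_Z], so [gH(I_mu Z, w) = (f_H / f_Z^2)
    alpha_mu(w)] and the factor [1 / f_H] of [S] cancels. The cubic terms come from the [alpha_mu^2]
    in [gH]. *)
Let gH_Sq p (hu u v w : tangent p) :
  let gZ (x : tangent p) := g p (Z p) x in
  let g1 (x : tangent p) := g p (I1 p (Z p)) x in
  let g2 (x : tangent p) := g p (I2 p (Z p)) x in
  let g3 (x : tangent p) := g p (I3 p (Z p)) x in
  gH g I1 I2 I3 Z fZ (Sq hu u v) w =
  2^-1 * (fZ p)^-1 ^+ 2 * (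
    g p hu v * gZ w + g p (I1 p hu) v * g1 w + g p (I2 p hu) v * g2 w +
    g p (I3 p hu) v * g3 w +
    g1 u * g p v w + g1 v * g p u w - gZ u * g p (I1 p v) w - gZ v * g p (I1 p u) w +
    g2 u * g p (I3 p v) w + g2 v * g p (I3 p u) w -
    g3 u * g p (I2 p v) w - g3 v * g p (I2 p u) w) +
  (fZ p)^-1 ^+ 3 * (
    (g1 u * gZ v + g1 v * gZ u) * gZ w +
    (g1 u * g1 v - gZ u * gZ v - g2 u * g2 v - g3 u * g3 v) * g1 w +
    (g1 u * g2 v + g1 v * g2 u) * g2 w + (g1 u * g3 v + g1 v * g3 u) * g3 w).
Proof.
move=> /=; rewrite gHE /Sq.
have fHZ : g p (Z p) (Z p) = fH g Z fZ p - fZ p.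
  by rewrite /fH sfunDE addrC addKr.
rewrite !(tensor2Dl, tensor2Zl, tensor2Nl, tensor2Dr, tensor2Zr, tensor2Nr).
rewrite !(skew1, skew2, skew3, I11, I22, I33, I12, I21, I13, I31, I23, I32,
  tensor2Nl, opprK, endofieldN) !(skewZ1, skewZ2, skewZ3) fHZ.
move: (fH_unit p) (fZ_unit p); set F := fZ p; set H := fH g Z fZ p => H0 F0.
move: (g p hu v) (g p (I1 p hu) v) (g p (I2 p hu) v) (g p (I3 p hu) v) => h0 h1 h2 h3.
move: (g p v w) (g p (I1 p v) w) (g p (I2 p v) w) (g p (I3 p v) w) => vw0 vw1 vw2 vw3.
move: (g p u w) (g p (I1 p u) w) (g p (I2 p u) w) (g p (I3 p u) w) => uw0 uw1 uw2 uw3.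
move: (g p (Z p) u) (g p (I1 p (Z p)) u) (g p (I2 p (Z p)) u) (g p (I3 p (Z p)) u)
  => u0 u1 u2 u3.
move: (g p (Z p) v) (g p (I1 p (Z p)) v) (g p (I2 p (Z p)) v) (g p (I3 p (Z p)) v)
  => v0 v1 v2 v3.
move: (g p (Z p) w) (g p (I1 p (Z p)) w) (g p (I2 p (Z p)) w) (g p (I3 p (Z p)) w)
  => w0 w1 w2 w3.
clearbody F H; field; by rewrite F0 H0.
Qed.

Lemma nablaS_metric : metric_connection gH_tensor2 nablaS.
Proof.
move=> A B C; apply: sfunP => p.
have -> : t2_app gH_tensor2 B C = gHs B C by apply: sfunP => q; rewrite gHsE.
rewrite -[LHS]/(A p (gHs B C)).
(* Leibniz rule with [d f_Z = - alpha_1], which gives the first two groups. The last group holds the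
   derivatives of [B] and [C], accounted for by the [D] part of the connection. *)
have -> : A p (gHs B C) =
    g p (I1 p (Z p)) (A p) * (fZ p)^-1 ^+ 2 * g p (B p) (C p) +
    2 * g p (I1 p (Z p)) (A p) * (fZ p)^-1 ^+ 3 * (
      g p (Z p) (B p) * g p (Z p) (C p) + g p (I1 p (Z p)) (B p) * g p (I1 p (Z p)) (C p) +
      g p (I2 p (Z p)) (B p) * g p (I2 p (Z p)) (C p) +
      g p (I3 p (Z p)) (B p) * g p (I3 p (Z p)) (C p)) +
    (fZ p)^-1 ^+ 2 * (
      g p (D A Z p) (B p) * g p (Z p) (C p) + g p (Z p) (B p) * g p (D A Z p) (C p) +
      g p (I1 p (D A Z p)) (B p) * g p (I1 p (Z p)) (C p) +
      g p (I1 p (Z p)) (B p) * g p (I1 p (D A Z p)) (C p) +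
      g p (I2 p (D A Z p)) (B p) * g p (I2 p (Z p)) (C p) +
      g p (I2 p (Z p)) (B p) * g p (I2 p (D A Z p)) (C p) +
      g p (I3 p (D A Z p)) (B p) * g p (I3 p (Z p)) (C p) +
      g p (I3 p (Z p)) (B p) * g p (I3 p (D A Z p)) (C p)) +
    (gH g I1 I2 I3 Z fZ (D A B p) (C p) + gH g I1 I2 I3 Z fZ (B p) (D A C p)).
  have dg X Y : A p (t2_app g X Y) = g p (D A X p) (Y p) + g p (X p) (D A Y p).
    by rewrite -[LHS]/(vf_deriv A (t2_app g X Y) p) LC.1.
  have invE : invZ p = (fZ p)^-1 by [].
  have t2E X Y : t2_app g X Y p = g p (X p) (Y p) by [].
  have efE J X : ef_app J X p = J p (X p) by [].
  rewrite /gHs Defs.tanD !(tan_leibniz, expr2) !(sfunDE, sfunME, t2E) !Defs.tanD.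
  rewrite !tan_leibniz vf_deriv_inv vf_deriv_moment !invE.
  rewrite !(deriv_alpha _ _ _ par1) !(deriv_alpha _ _ _ par2) !(deriv_alpha _ _ _ par3).
  rewrite !dg !t2E !efE !gHE; ring.
rewrite sfunDE -[t2_app gH_tensor2 (nablaS A B) C p]/(gH g I1 I2 I3 Z fZ (nablaS A B p) (C p)).
rewrite -[t2_app gH_tensor2 B (nablaS A C) p]/(gH_tensor2 p (B p) (nablaS A C p)).
have gH_D (u v w : tangent p) : gH g I1 I2 I3 Z fZ (u + v) w =
    gH g I1 I2 I3 Z fZ u w + gH g I1 I2 I3 Z fZ v w := tensor2Dl gH_tensor2 u v w.
rewrite gH_sym !nablaSE vfDE vfDE tensor2Dl.
rewrite gH_D -[gH_tensor2 p (D A C p) _]gH_sym.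
rewrite -[gH_tensor2 p (B p) (D A C p)]/(gH g I1 I2 I3 Z fZ (B p) (D A C p)).
rewrite -[gH_tensor2 p (Sfield A C p) (B p)]/(gH g I1 I2 I3 Z fZ (Sfield A C p) (B p)).
rewrite [RHS]addrACA [RHS]addrC; congr (_ + _).
rewrite !Sfield_quat -!/(Sq _ _ _) !gH_Sq.
have -> : D A Z p = 2^-1 *: (h A p - I1 p (A p)).
  by apply: tanP => f; rewrite tanZE IHE mulr2n !(tanDE, tanNE); field.
rewrite !(tensor2Zl, tensor2Bl, endofieldZ, endofieldD, endofieldN, tensor2Dl, tensor2Nl).
rewrite !(I11, I21, I31, opprK, tensor2Nl).
have swap J : (forall u v, g p u (J p v) = - g p (J p u) v) ->
    g p (J p (C p)) (B p) = - g p (J p (B p)) (C p).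
  by move=> skewJ; rewrite gC skewJ.
rewrite (swap _ (@skew1 p)) (swap _ (@skew2 p)) (swap _ (@skew3 p)) (gC (C p) (B p)).
move: (h A p) => hA; field; exact: fZ_unit.
Qed.

(** * Invariance of [D + S] under [Z] *)

Let lie_h A : bracket Z (h A) = h (bracket Z A).
Proof.
have DZ0 : D A 0 = 0.
  by apply: (addrI (D A 0)); rewrite -conn_additive !addr0.
have DZ : bracket Z (D A Z) = D (bracket Z A) Z.
  by rewrite (killing_connection _ _ metric_g LC killZ) bracketZ0 DZ0 addr0.
by rewrite /h /IH !mulr2n !bracketDr lie1 DZ.
Qed.

Let bracketNr X : bracket Z (- X) = - bracket Z X.
Proof.
have Z0 : bracket Z 0 = 0 by apply: (addrI (bracket Z 0)); rewrite -bracketDr !addr0.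
by apply: (addIr (bracket Z X)); rewrite -bracketDr !addNr.
Qed.

(** All ingredients except [J] are invariant, so the error replaces one [J] at a time by its Lie
    derivative [K]. [K] is a plain function on fields, which allows [0] and [- I_2]. *)
Let lie_Sterm (J : endofield N) (K : vfield N -> vfield N) A B :
  (forall X, bracket Z (ef_app J X) = ef_app J (bracket Z X) + K X) ->
  bracket Z (Sterm J A B) = Sterm J (bracket Z A) B + Sterm J A (bracket Z B) +
    ((invH * t2_app g (K (h A)) B) *: ef_app J Z +
     (invH * t2_app g (ef_app J (h A)) B) *: K Z -
     invZ *: (t2_app g (K Z) A *: ef_app J (ef_app I1 B) +
              t2_app g (ef_app J Z) A *: K (ef_app I1 B) +
              t2_app g (K Z) B *: ef_app J (ef_app I1 A) +
              t2_app g (ef_app J Z) B *: K (ef_app I1 A))).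
Proof.
move=> lieJ; rewrite /Sterm bracketDr bracketNr !bracketZr bracketDr !bracketZr.
rewrite !vf_deriv_leibniz invariant_invZ invariant_invH !killZ !lieJ !lie_h !lie1 bracketZ0.
have J0 : ef_app J 0 = 0 by apply: vfP => p; exact: endofield0.
rewrite J0 add0r mulr0 addr0 scale0r add0r.
move: (h A) (h (bracket Z A)) (K Z) (K (h A)) => hA hZA KZ Kh.
move: (K (ef_app I1 B)) (K (ef_app I1 A)) => KB KA.
apply: vfP => p; apply: tanP => f.
rewrite !(vfDE, vfNE, vfZE, tanDE, tanNE, tanZE).
rewrite !(sfunDE, sfunME).
have t2E X Y : t2_app g X Y p = g p (X p) (Y p) by [].
rewrite !t2E vfDE tensor2Dl; ring.
Qed.

Let bracket_const (c : R) X : bracket Z (sfun_cst c *: X) = sfun_cst c *: bracket Z X.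
Proof.
have c0 : vf_deriv Z (sfun_cst c) = 0 by apply: sfunP => p; exact: tangent_cst.
by rewrite bracketZr c0 scale0r add0r.
Qed.

(** [J] enters each summand of [S] twice, and the Lie derivatives of [I_2], [I_3] are [I_3],
    [- I_2]: the errors of these two summands cancel, as for an infinitesimal rotation of the
    pair. *)
Lemma nablaS_invariant : invariant_conn Z nablaS.
Proof.
move=> A B; rewrite !nablaSE bracketDr (killing_connection _ _ metric_g LC killZ).
suff -> : bracket Z (Sfield A B) = Sfield (bracket Z A) B + Sfield A (bracket Z B).
  by rewrite addrACA.
have bracketD4 X0 X1 X2 X3 : bracket Z (X0 + X1 + X2 + X3) =
  bracket Z X0 + bracket Z X1 + bracket Z X2 + bracket Z X3 by rewrite !bracketDr.
rewrite /Sfield bracket_const bracketD4.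
rewrite (@lie_Sterm ef_id (fun=> 0)); last first.
  by move=> X; rewrite addr0; congr bracket; exact: vfP.
rewrite (@lie_Sterm I1 (fun=> 0)); last by move=> X; rewrite addr0.
rewrite (lie_Sterm _ _ lie2).
rewrite (@lie_Sterm I3 (fun X => - ef_app I2 X)); last exact: lie3.
rewrite -scalerDr; congr (_ *: _).
have t0 X : t2_app g 0 X = 0 by apply: sfunP => p; exact: tensor20l.
have tN X Y : t2_app g (- X) Y = - t2_app g X Y by apply: sfunP => p; exact: tensor2Nl.
rewrite !t0 !mulr0 !scale0r !scaler0 !addr0 !scaler0 !subr0 !addr0 !tN.
move: (Sterm ef_id (bracket Z A) B) (Sterm I1 (bracket Z A) B)
 (Sterm I2 (bracket Z A) B) (Sterm I3 (bracket Z A) B) => X0 X1 X2 X3.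
move: (Sterm ef_id A (bracket Z B)) (Sterm I1 A (bracket Z B))
 (Sterm I2 A (bracket Z B)) (Sterm I3 A (bracket Z B)) => Y0 Y1 Y2 Y3.
move: (h A) => hA; apply: vfP => p; apply: tanP => f.
rewrite !(vfDE, vfNE, vfZE, tanDE, tanNE, tanZE) !(sfunDE, sfunME, sfunNE).
ring.
Qed.

End HyperKaehlerQuotient.

(** * Transfer to the twist *)

Section TwistConnection.
Context {R : realType} {n : nat} {N : manifold R n} {Z : vfield N}.
Context {wH : tensor2 N} {f : smoothfun N} (t : twist Z wH f).
Hypothesis f_neq0 : forall p, f p != 0.

Let pi := tw_pi t.
Let j := tw_j t.
Let b := tw_pibar t.
Let eta := tw_eta t.

(** Both lifts are recorded because the curvature identity speaks of fields on the bundle, while the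
    projection to the twist is defined on the open part [tw_U]. *)
Definition is_horizontal_lift (A : vfield N) (V : vfield (tw_U t)) (VP : vfield (tw_P t)) :=
  [/\ related pi VP A, related j V VP & forall q, eta q (VP q) = 0].

Lemma vertical_eq0 q (v : tangent q) : differential pi v = 0 -> eta q v = 0 -> v = 0.
Proof.
have [_ _ ker _] := tw_principal t; move=> /(ker q v)[a ->].
by rewrite form1Z tw_eta_X mulr1 => ->; rewrite scale0r.
Qed.

Lemma differential_tw_X q : differential pi (tw_X t q) = 0.
Proof.
have [_ _ ker _] := tw_principal t.
by apply/(ker q); exists 1; rewrite scale1r.
Qed.

Lemma embedding_injective (u : tw_U t) : injective (@differential _ _ _ _ _ j u).
Proof. by have [_ _ /(_ u)] := tw_j_open t; exact: bij_inj. Qed.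

Lemma embedding_surjective (u : tw_U t) (v : tangent (j u)) : exists w, differential j w = v.
Proof.
by have [_ _ /(_ u)[inv _ invK]] := tw_j_open t; exists (inv v).
Qed.

Lemma exists_horizontal_lift A : exists V VP, is_horizontal_lift A V VP.
Proof.
have [VP [VPA VP0]] : exists VP, related pi VP A /\ forall q, eta q (VP q) = 0.
  apply: exists_lift => [q v|q]; first exact: vertical_eq0.
  have [_ /(_ q (A (pi q)))[v vA] _ _] := tw_principal t.
  exists (v - eta q v *: tw_X t q).
  rewrite differentialB differentialZ differential_tw_X scaler0 subr0 vA.
  by rewrite form1B form1Z tw_eta_X mulr1 subrr.
have zero_linear (u : tw_U t) (a : R) (v w : tangent u) : (0 : R) = a * 0 + 0.
  by rewrite mulr0 addr0.
(* The differential of the open embedding is already injective, so the lifting lemma is applied with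
   the zero form. *)
pose zero : form1 (tw_U t) := Form1 zero_linear (fun _ => is_smooth_cst 0).
have [V [VVP _]] : exists V, related j V VP /\ forall u, zero u (V u) = 0.
  apply: exists_lift => [u v v0 _|u].
    by apply: embedding_injective; rewrite v0 differential0.
  by have [w wVP] := embedding_surjective (VP (j u)); exists w.
by exists V, VP.
Qed.

Lemma horizontal_lift_horizontal A V VP (u : tw_U t) :
  is_horizontal_lift A V VP -> horizontal (V u).
Proof. by move=> [_ VVP VP0]; rewrite /horizontal VVP. Qed.

Lemma horizontal_lift_base A V VP (u : tw_U t) :
  is_horizontal_lift A V VP -> to_base (V u) = A (pi (j u)).
Proof. by move=> [VPA VVP _]; rewrite /to_base VVP VPA. Qed.

Lemma horizontal_inj (u : tw_U t) (h k : tangent u) : horizontal h -> horizontal k ->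
  to_base h = to_base k -> h = k.
Proof.
rewrite /horizontal /to_base => h0 k0 hk; apply: embedding_injective.
apply/eqP; rewrite -subr_eq0; apply/eqP; apply: vertical_eq0.
  by rewrite differentialB hk subrr.
by rewrite form1B h0 k0 subrr.
Qed.

Lemma tw_ZU_eta (u : tw_U t) : eta (j u) (differential j (tw_ZU t u)) = f (pi (j u)).
Proof.
rewrite tw_ZUE; have [h [h0 _ ->]] := tw_ZPE (j u).
by rewrite form1D h0 add0r form1Z tw_eta_X mulr1.
Qed.

Lemma tw_ZU_base (u : tw_U t) : to_base (tw_ZU t u) = Z (pi (j u)).
Proof.
rewrite /to_base tw_ZUE; have [h [_ hZ ->]] := tw_ZPE (j u).
by rewrite differentialD differentialZ differential_tw_X scaler0 addr0.
Qed.

Lemma tw_ZU_twist (u : tw_U t) : to_twist (tw_ZU t u) = 0.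
Proof.
have [_ _ ker _] := tw_quotient t.
by apply/(ker u); exists 1; rewrite scale1r.
Qed.

(** Since [eta(Z_P) = f] has no zeros, any preimage can be moved into [ker eta] along [Z_P], which
    does not change its projection. *)
Lemma to_twist_surjective (u : tw_U t) (v : tangent (b u)) :
  exists2 h : tangent u, horizontal h & to_twist h = v.
Proof.
have [_ /(_ u v)[w wv] _ _] := tw_quotient t.
exists (w - (f (pi (j u)))^-1 * eta (j u) (differential j w) *: tw_ZU t u).
  rewrite /horizontal differentialB differentialZ form1B form1Z tw_ZU_eta.
  by rewrite mulrAC mulVf// mul1r subrr.
rewrite /to_twist differentialB differentialZ -/(to_twist (tw_ZU t u)).
by rewrite tw_ZU_twist scaler0 subr0.
Qed.

(** A horizontal vector is determined by its image in [N], so the vector provided by [hrel_vf] is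
    the value of the lift. *)
Lemma horizontal_lift_related A (A' : vfield (tw_Nbar t)) V VP : is_horizontal_lift A V VP ->
  hrel_vf A A' -> related b V A'.
Proof.
move=> VA [_ AA'] u; have [h [h0 hA <-]] := AA' u.
congr (differential b _); apply: horizontal_inj h0 _.
  exact: horizontal_lift_horizontal VA.
by rewrite (horizontal_lift_base _ VA) hA.
Qed.

(** * Comparison of the two Koszul formulas on the bundle *)

Section Metric.
Variables (gN : tensor2 N) (gQ : tensor2 (tw_Nbar t)).
Hypothesis gNQ : hrel_tensor2 gN gQ.

Let G := pullback_tensor2 b gQ.

Lemma pullback_lift A B V W VP WP : is_horizontal_lift A V VP ->
  is_horizontal_lift B W WP ->
  forall u, t2_app G V W u = t2_app gN A B (pi (j u)).
Proof.
move=> VA WB u; rewrite -[LHS]/(gQ _ (to_twist (V u)) (to_twist (W u))).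
rewrite -gNQ; [|exact: horizontal_lift_horizontal VA|exact: horizontal_lift_horizontal WB].
by rewrite (horizontal_lift_base _ VA) (horizontal_lift_base _ WB).
Qed.

Lemma pullback_lift_deriv A B C V W X VP WP XP : is_horizontal_lift A V VP ->
  is_horizontal_lift B W WP -> is_horizontal_lift C X XP ->
  forall u, vf_deriv V (t2_app G W X) u = vf_deriv A (t2_app gN B C) (pi (j u)).
Proof.
move=> VA WB XC u.
have -> : t2_app G W X = pullback j (pullback pi (t2_app gN B C)).
  by apply: sfunP => v; rewrite (pullback_lift WB XC).
rewrite -[LHS]/(to_base (V u) (t2_app gN B C)).
by rewrite (horizontal_lift_base _ VA).
Qed.

(* The vertical part of the bracket of two horizontal lifts is minus the
   curvature; modulo [Z_P], which projects to 0 on the twist, it becomes the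
   multiple [wH / f] of [Z]. *)
Lemma pullback_lift_bracket A B C V W X VP WP XP : is_horizontal_lift A V VP ->
  is_horizontal_lift B W WP -> is_horizontal_lift C X XP ->
  forall u, let p := pi (j u) in t2_app G (bracket V W) X u =
    gN p (bracket A B p + ((f p)^-1 * wH p (A p) (B p)) *: Z p) (C p).
Proof.
move=> VA WB XC u p.
have [VPA VVP VP0] := VA; have [WPB WWP WP0] := WB.
(* [eta] vanishes on both lifts, so [ext_d] reduces to minus [eta] of the bracket. *)
have eta_br : eta (j u) (differential j (bracket V W u)) = - wH p (A p) (B p).
  rewrite (related_bracket VVP WWP).
  have := tw_curvature VP WP (j u); rewrite /ext_d VPA WPB => <-.
  have f0 (Y : vfield (tw_P t)) : (forall q, eta q (Y q) = 0) -> f1_app eta Y = 0.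
    by move=> Y0; apply: sfunP => q; exact: Y0.
  rewrite !(sfunDE, sfunNE) /= -/eta (f0 _ VP0) (f0 _ WP0) !tangent0.
  by rewrite oppr0 addr0 add0r opprK.
have base_br : to_base (bracket V W u) = bracket A B p.
  by rewrite /to_base (related_bracket VVP WWP) (related_bracket VPA WPB).
pose c := (f p)^-1 * wH p (A p) (B p).
pose w := bracket V W u + c *: tw_ZU t u.
have w0 : horizontal w.
  rewrite /horizontal differentialD differentialZ form1D form1Z eta_br tw_ZU_eta.
  by rewrite /c mulrAC mulVf// mul1r addNr.
have -> : t2_app G (bracket V W) X u = gQ _ (to_twist w) (to_twist (X u)).
  rewrite {1}/to_twist differentialD differentialZ -/(to_twist (tw_ZU t u)).
  by rewrite tw_ZU_twist scaler0 addr0.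
rewrite -gNQ//; last exact: horizontal_lift_horizontal XC.
rewrite (horizontal_lift_base _ XC) {1}/to_base differentialD differentialZ.
rewrite differentialD differentialZ -/(to_base (tw_ZU t u)) tw_ZU_base.
by rewrite -/(to_base (bracket V W u)) base_br.
Qed.

Variables (DQ : connection (tw_Nbar t)) (nabla : connection N).
Hypotheses (metricQ : is_metric gQ) (levi_civitaQ : is_levi_civita gQ DQ).
Hypothesis gN_sym : forall p (u v : tangent p), gN p u v = gN p v u.
Hypothesis nabla_metric : metric_connection gN nabla.
Hypothesis nabla_torsion : forall A B p, (nabla A B - nabla B A) p =
  bracket A B p + ((f p)^-1 * wH p (A p) (B p)) *: Z p.
Hypothesis nabla_invariant : invariant_conn Z nabla.

Lemma twist_connection : hrel_conn nabla DQ.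
Proof.
split=> // A A' B B' AA' BB'; split.
  have [ZA _] := AA'; have [ZB _] := BB'; rewrite /invariant_vf nabla_invariant ZA ZB.
  have -> : nabla 0 B = 0.
    by apply: (addrI (nabla 0 B)); rewrite -{1}[nabla 0 B]scale1r -conn_linear scaler0 !addr0.
  by rewrite add0r; apply: (addrI (nabla A 0)); rewrite -conn_additive !addr0.
have [V [VP VA]] := exists_horizontal_lift A.
have [W [WP WB]] := exists_horizontal_lift B.
have [Y [YP YAB]] := exists_horizontal_lift (nabla A B).
move=> u; exists (Y u); split.
- exact: horizontal_lift_horizontal YAB.
- exact: horizontal_lift_base YAB.
(* The projected lift of [nabla A B] is compared with [DQ A' B'] by pairing with an arbitrary vector
   of the twist, represented by a horizontal [h]. *)
apply/eqP; rewrite -subr_eq0; apply/eqP; apply: metricQ.2 => v'.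
have [h h0 <-] := to_twist_surjective v'.
(* [C] is an arbitrary extension; its lift has value [h] at [u] and is used in the third Koszul slot
   only. *)
have [C CE] := extend_tangent (to_base h).
have [X [XP XC]] := exists_horizontal_lift C.
have -> : h = X u.
  apply: horizontal_inj => //; first exact: horizontal_lift_horizontal XC.
  by rewrite (horizontal_lift_base _ XC) CE.
rewrite tensor2Bl; apply/eqP; rewrite subr_eq0; apply/eqP.
set p := pi (j u).
have lhs : gQ _ (to_twist (Y u)) (to_twist (X u)) = gN p (nabla A B p) (C p).
  rewrite -gNQ; last 2 first.
  - exact: horizontal_lift_horizontal YAB.
  - exact: horizontal_lift_horizontal XC.
  by rewrite (horizontal_lift_base _ YAB) (horizontal_lift_base _ XC).
rewrite lhs.
have K1 := koszul_pullback X metricQ levi_civitaQ (horizontal_lift_related VA AA')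
  (horizontal_lift_related WB BB') u.
have K2 := metric_connection_koszul A B C p gN_sym nabla_metric.
(* Each term of the formula for [gQ] is replaced by its counterpart on [N]; the corrected brackets
   become the differences [nabla A B - nabla B A] of the formula for [gN]. *)
move: K1; rewrite /koszul_form !(sfunDE, sfunNE).
rewrite (pullback_lift_deriv VA WB XC) (pullback_lift_deriv WB VA XC).
rewrite (pullback_lift_deriv XC VA WB).
rewrite (pullback_lift_bracket VA WB XC) (pullback_lift_bracket VA XC WB).
rewrite (pullback_lift_bracket WB XC VA) -!nabla_torsion K2 !mulr2n -/b -/(to_twist _).
lra.
Qed.

End Metric.
End TwistConnection.

Theorem theorem3p1 (R : realType) (n : nat) (N : manifold R n)
  (g : tensor2 N) (D : connection N) (I1 I2 I3 : endofield N)
  (Z : vfield N) (fZ : smoothfun N) (omegaH : tensor2 N)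
  (hyperkaehlerN : is_hyperkaehler g D I1 I2 I3)
  (circleZ : generates_free_circle_action Z)
  (rotatingZ : is_rotating g I1 I2 I3 Z)
  (momentZ : is_moment_map g I1 Z fZ)
  (fZ_neq0 : forall p, fZ p <> 0)
  (fH_neq0 : forall p, fH g Z fZ p <> 0)
  (omegaHE : is_omegaH g I1 Z omegaH)
  (t : twist Z omegaH (fH g Z fZ))
  (gQ : tensor2 (tw_Nbar t)) (metricQ : is_metric gQ)
  (gHQ : hrel_tensor2 (@gH R n N g I1 I2 I3 Z fZ) gQ)
  (DQ : connection (tw_Nbar t)) (levi_civitaQ : is_levi_civita gQ DQ) :
  exists nablaS : connection N,
    (forall A B p, nablaS A B p = D A B p + S_at g D I1 I2 I3 Z fZ A B p) /\
    hrel_conn nablaS DQ.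
Proof.
exists (nablaS D I1 I2 I3 fZ_neq0 fH_neq0); split=> [A B p|].
  by rewrite nablaSE vfDE SfieldE.
apply: (@twist_connection _ _ _ _ _ _ t _ (gH_tensor2 g I1 I2 I3 Z fZ_neq0) gQ) => //.
- by move=> p; apply/eqP.
- exact: gH_sym hyperkaehlerN _.
- exact: nablaS_metric.
- move=> A B p; rewrite nablaS_torsion//.
  by rewrite -(omegaH_IH hyperkaehlerN rotatingZ A B p omegaHE).
- exact: nablaS_invariant.
Qed.
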